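(* Let $1\le q\le\infty$, let $T:(X_0,X_1)\to(Y_0,Y_1)$ be a bounded linear operator between Banach couples, and let $I\subset(0,1)$ be an interval of invertibility of $T$ with respect to the family $\{(\,\cdot\,)_{\theta,q}\}_{\theta\in(0,1)}$ of real interpolation functors. Then for any $\theta_0,\theta_1\in I$ the inverse operators $T_{\theta_0}^{-1}:(Y_0,Y_1)_{\theta_0,q}\to(X_0,X_1)_{\theta_0,q}$ and $T_{\theta_1}^{-1}:(Y_0,Y_1)_{\theta_1,q}\to(X_0,X_1)_{\theta_1,q}$ agree on $(Y_0,Y_1)_{\theta_0,q}\cap(Y_0,Y_1)_{\theta_1,q}$.
   Context: $\vec A_{\theta,q}=(A_0,A_1)_{\theta,q}$ is the real interpolation space of $a\in A_0+A_1$ with $\|a\|_{\theta,q}=\big(\int_0^\infty(t^{-\theta}K(t,a;\vec A))^q\,dt/t\big)^{1/q}<\infty$ (for $q=\infty$: $\sup_{t>0}t^{-\theta}K(t,a;\vec A)$), $K(t,a;\vec A)=\inf\{\|a_0\|_{A_0}+t\|a_1\|_{A_1}:a=a_0+a_1\}$. $T_\theta$ is the restriction $T:(X_0,X_1)_{\theta,q}\to(Y_0,Y_1)_{\theta,q}$. The set of $\theta\in(0,1)$ for which $T_\theta$ is invertible is open; an interval of invertibility is an open interval on which $T_\theta$ is invertible for all $\theta$ (a connected component of that set). *)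

(* Defs.v *)
From HB Require Import structures.
From mathcomp Require Import all_boot all_order all_algebra.
From mathcomp Require Import all_classical all_reals all_analysis.
Set Implicit Arguments. Unset Strict Implicit. Unset Printing Implicit Defensive.
Import Order.TTheory GRing.Theory Num.Theory.
Import numFieldTopology.Exports numFieldNormedType.Exports.
Local Open Scope classical_set_scope.
Local Open Scope ring_scope.

Section Couples.
Variable R : realType.

(** A pair of normed subspaces (A0, n0), (A1, n1) of an ambient
    topological vector space V. *)
Record couple (V : topologicalLmodType R) := Couple {
  cA0 : set V; cA1 : set V; cn0 : V -> R; cn1 : V -> R }.

Variable V : topologicalLmodType R.

Definition is_subspace (A : set V) :=
  [/\ A 0, (forall a b, A a -> A b -> A (a + b))
     & (forall (k : R) a, A a -> A (k *: a))].

Definition is_norm_on (A : set V) (n : V -> R) :=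
  [/\ (forall a, A a -> 0 <= n a),
      (forall a, A a -> n a = 0 -> a = 0),
      (forall a b, A a -> A b -> n (a + b) <= n a + n b)
    & (forall (k : R) a, A a -> n (k *: a) = `|k| * n a)].

Definition complete_on (A : set V) (n : V -> R) :=
  forall u : nat -> V, (forall k, A (u k)) ->
    (forall e : R, 0 < e -> exists N, forall m p, (N <= m)%N -> (N <= p)%N ->
        n (u m - u p) < e) ->
    exists a, A a /\ forall e : R, 0 < e -> exists N, forall m, (N <= m)%N ->
        n (u m - a) < e.

(** the inclusion (A, n) -> V is continuous (it is linear, so continuity at 0) *)
Definition cont_embedded (A : set V) (n : V -> R) :=
  forall B : set V, nbhs (0 : V) B ->
    exists e : R, 0 < e /\ forall a, A a -> n a < e -> B a.

Definition banach_in (A : set V) (n : V -> R) :=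
  [/\ is_subspace A, is_norm_on A n, complete_on A n & cont_embedded A n].

Definition banach_couple (X : couple V) :=
  [/\ hausdorff_space V, banach_in (cA0 X) (cn0 X) & banach_in (cA1 X) (cn1 X)].

Definition sumspace (X : couple V) : set V :=
  [set a | exists a0 a1, [/\ cA0 X a0, cA1 X a1 & a = a0 + a1]].

Definition Kfun (X : couple V) (t : R) (a : V) : \bar R :=
  ereal_inf [set x | exists a0 a1,
     [/\ cA0 X a0, cA1 X a1, a = a0 + a1 & x = (cn0 X a0 + t * cn1 X a1)%:E]].

Local Open Scope ereal_scope.

Definition interp_norm (X : couple V) (theta : R) (q : \bar R) (a : V) : \bar R :=
  match q with
  | +oo => ereal_sup [set x | exists t : R, (0 < t)%R /\
                        x = (t `^ (- theta))%:E * Kfun X t a]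
  | r%:E => (\int[lebesgue_measure]_(t in `]0%R, +oo[)
               (((t `^ (- theta))%:E * Kfun X t a) `^ r * (t^-1)%:E)) `^ (r^-1)
  | -oo => +oo
  end.

Definition interp_space (X : couple V) (theta : R) (q : \bar R) : set V :=
  [set a | sumspace X a /\ interp_norm X theta q a < +oo].

End Couples.

Local Open Scope ereal_scope.

Section Operators.
Variables (R : realType) (U W : topologicalLmodType R).

Definition linear_on (A : set U) (T : U -> W) :=
  (forall a b, A a -> A b -> T (a + b)%R = (T a + T b)%R) /\
  (forall (k : R) a, A a -> T (k *: a)%R = (k *: T a)%R).

Definition bounded_between (A : set U) (nA : U -> R) (B : set W) (nB : W -> R)
  (T : U -> W) :=
  (forall a, A a -> B (T a)) /\
  exists C : R, forall a, A a -> (nB (T a) <= C * nA a)%R.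

Definition couple_operator (X : couple U) (Y : couple W) (T : U -> W) :=
  [/\ linear_on (sumspace X) T,
      bounded_between (cA0 X) (cn0 X) (cA0 Y) (cn0 Y) T
    & bounded_between (cA1 X) (cn1 X) (cA1 Y) (cn1 Y) T].

Definition interp_invertible (X : couple U) (Y : couple W) (T : U -> W)
  (q : \bar R) (theta : R) :=
  [/\ (forall y, interp_space Y theta q y ->
          exists x, interp_space X theta q x /\ T x = y),
      (forall x1 x2, interp_space X theta q x1 -> interp_space X theta q x2 ->
          T x1 = T x2 -> x1 = x2)
    & exists C : R, forall x, interp_space X theta q x ->
          interp_norm X theta q x <= C%:E * interp_norm Y theta q (T x)].

Definition invertibility_set X Y T q : set R :=
  [set theta | [/\ (0 < theta)%R, (theta < 1)%R & interp_invertible X Y T q theta]].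

Definition invertibility_interval X Y T q (I : set R) :=
  exists theta, invertibility_set X Y T q theta /\
    I = connected_component (invertibility_set X Y T q) theta.

End Operators.

(* Main.v *)
(** The theorem says that T is injective on (X_0,X_1)_{theta,q} +
    (X_0,X_1)_{theta',q}, first for theta' close to theta and then, by
    connectedness, along the interval. Let T z = 0 with z in that sum, put
    phi(n) = min(1, 2^((theta - theta') n)), and let z = s_n + r_n be
    near-optimal for K(2^n, z). The element
      a = phi(n) z + \sum_(k >= n) (phi(k+1) - phi(k)) r_k
                   - \sum_(k < n) (phi(k+1) - phi(k)) s_k
    does not depend on n, and as |phi(k+1) - phi(k)| <= delta phi(k) with delta
    small for theta' close to theta, a Hardy-type inequality bounds a - phi(n) z
    at scale 2^n by delta times the norm N of the sequence
    phi(n) 2^(-theta n) K(2^n, z). Since T z = 0, the same bound holds for T a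
    in Y, and invertibility at theta transfers it to a; hence N <= C delta N,
    so that N = 0 and z = 0. *)

Require Import Defs.
From HB Require Import structures.
From mathcomp Require Import all_boot all_order all_algebra.
From mathcomp Require Import all_classical all_reals all_analysis.
From mathcomp Require Import measurable_realfun.
From mathcomp Require Import zify ring lra.
Import Order.TTheory GRing.Theory Num.Theory.
Import numFieldTopology.Exports numFieldNormedType.Exports.
Local Open Scope classical_set_scope.
Local Open Scope ring_scope.

Set Implicit Arguments.
Unset Strict Implicit.
Unset Printing Implicit Defensive.

(** * The K-functional *)

(** Working with reals is harmless on [sumspace X], where the infimum is finite ([KfunE]). Outside
    it the infimum is +oo and [fine] returns the default 0, hence the membership hypotheses
    below. *)
Definition kfun {R : realType} {V : topologicalLmodType R} (X : couple V)
  (t : R) (a : V) : R := fine (Kfun X t a).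

Lemma subspaceN (R : realType) (V : topologicalLmodType R) (A : set V) (a : V) :
  is_subspace A -> A a -> A (- a).
Proof. by move=> [_ _ h] Aa; rewrite -scaleN1r; exact: h. Qed.

Lemma normN (R : realType) (V : topologicalLmodType R) (A : set V) (n : V -> R)
  (a : V) : is_norm_on A n -> A a -> n (- a) = n a.
Proof. by move=> [_ _ _ h] Aa; rewrite -scaleN1r h// normrN1 mul1r. Qed.

Lemma norm0 (R : realType) (V : topologicalLmodType R) (A : set V) (n : V -> R) :
  is_subspace A -> is_norm_on A n -> n 0 = 0.
Proof. by move=> [A0 _ _] [_ _ _ h]; rewrite -(scale0r 0) h// normr0 mul0r. Qed.

Lemma sumspaceD (R : realType) (V : topologicalLmodType R) (X : couple V)
  (a b : V) : banach_couple X -> sumspace X a -> sumspace X b ->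
  sumspace X (a + b).
Proof.
move=> [_ [[_ D0 _] _ _ _] [[_ D1 _] _ _ _]].
move=> [a0 [a1 [Aa0 Aa1 ->]]] [b0 [b1 [Ab0 Ab1 ->]]].
by exists (a0 + b0), (a1 + b1); split; [exact: D0|exact: D1|rewrite addrACA].
Qed.

Lemma sumspaceZ (R : realType) (V : topologicalLmodType R) (X : couple V)
  (c : R) (a : V) : banach_couple X -> sumspace X a -> sumspace X (c *: a).
Proof.
move=> [_ [[_ _ Z0] _ _ _] [[_ _ Z1] _ _ _]] [a0 [a1 [Aa0 Aa1 ->]]].
by exists (c *: a0), (c *: a1); split; [exact: Z0|exact: Z1|rewrite scalerDr].
Qed.

Lemma sumspace0 (R : realType) (V : topologicalLmodType R) (X : couple V)
  (a : V) : banach_couple X -> cA0 X a -> sumspace X a.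
Proof.
by move=> [_ _ [[A10 _ _] _ _ _]] Aa; exists a, 0; rewrite addr0.
Qed.

Lemma sumspace1 (R : realType) (V : topologicalLmodType R) (X : couple V)
  (a : V) : banach_couple X -> cA1 X a -> sumspace X a.
Proof.
by move=> [_ [[A00 _ _] _ _ _] _] Aa; exists 0, a; rewrite add0r.
Qed.

Lemma Kfun_ge0 (R : realType) (V : topologicalLmodType R) (X : couple V)
  (t : R) (a : V) : banach_couple X -> 0 <= t -> (0 <= Kfun X t a)%E.
Proof.
move=> [_ [_ [n0 _ _ _] _ _] [_ [n1 _ _ _] _ _]] t0.
apply: le_ereal_inf_tmp => _ [a0 [a1 [/n0 h0 /n1 h1 _ ->]]].
by rewrite lee_fin addr_ge0// mulr_ge0.
Qed.

Lemma KfunE (R : realType) (V : topologicalLmodType R) (X : couple V)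
  (t : R) (a : V) : banach_couple X -> 0 <= t -> sumspace X a ->
  Kfun X t a = (kfun X t a)%:E.
Proof.
move=> bX t0 [a0 [a1 [Aa0 Aa1 aE]]]; rewrite /kfun fineK//.
rewrite ge0_fin_numE ?Kfun_ge0//.
apply: (@le_lt_trans _ _ (cn0 X a0 + t * cn1 X a1)%:E); last exact: ltry.
by apply: ereal_inf_lbound; exists a0, a1.
Qed.

Lemma kfun_ge0 (R : realType) (V : topologicalLmodType R) (X : couple V)
  (t : R) (a : V) : banach_couple X -> 0 <= t -> 0 <= kfun X t a.
Proof. by move=> bX t0; rewrite fine_ge0// Kfun_ge0. Qed.

Lemma kfun_le (R : realType) (V : topologicalLmodType R) (X : couple V)
  (t : R) (a0 a1 : V) : banach_couple X -> 0 <= t -> cA0 X a0 -> cA1 X a1 ->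
  kfun X t (a0 + a1) <= cn0 X a0 + t * cn1 X a1.
Proof.
move=> bX t0 Aa0 Aa1; rewrite -lee_fin -KfunE//; last by exists a0, a1.
by apply: ereal_inf_lbound; exists a0, a1.
Qed.

Lemma kfun_lt (R : realType) (V : topologicalLmodType R) (X : couple V)
  (t c : R) (a : V) : banach_couple X -> 0 <= t -> sumspace X a ->
  kfun X t a < c -> exists a0 a1, [/\ cA0 X a0, cA1 X a1, a = a0 + a1 &
    cn0 X a0 + t * cn1 X a1 < c].
Proof.
move=> bX t0 sa; rewrite -lte_fin -KfunE// => /ereal_inf_lt.
by move=> [_ [a0 [a1 [Aa0 Aa1 aE ->]]]]; rewrite lte_fin => h; exists a0, a1.
Qed.

Lemma ler_kfun (R : realType) (V : topologicalLmodType R) (X : couple V)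
  (s t : R) (a : V) : banach_couple X -> 0 <= s -> s <= t -> sumspace X a ->
  kfun X s a <= kfun X t a.
Proof.
move=> bX s0 st sa; apply/ler_addgt0Pr => e e0.
have t0 : 0 <= t := le_trans s0 st.
have [] := @kfun_lt _ _ X t (kfun X t a + e) a bX t0 sa; first by rewrite ltrDl.
move=> a0 [a1 [Aa0 Aa1 -> /ltW]]; apply: le_trans.
apply: (le_trans (kfun_le _ _ _ _)) => //; rewrite lerD2l ler_wpM2r//.
by case: bX => _ _ [_ [n1 _ _ _] _ _]; exact: n1.
Qed.

(** The same decomposition serves both scales, since n0 + c t n1 <= c (n0 + t n1) for c >= 1.
    Equivalently, K(t, a) / t is nonincreasing in t. *)
Lemma kfun_scale_le (R : realType) (V : topologicalLmodType R) (X : couple V)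
  (c t : R) (a : V) : banach_couple X -> 0 <= t -> 1 <= c -> sumspace X a ->
  kfun X (c * t) a <= c * kfun X t a.
Proof.
move=> bX t0 c1 sa; have c0 : 0 < c by exact: lt_le_trans c1.
rewrite -ler_pdivrMl//; apply/ler_addgt0Pr => e e0.
have [] := @kfun_lt _ _ X t (kfun X t a + e) a bX t0 sa; first by rewrite ltrDl.
move=> a0 [a1 [Aa0 Aa1 -> /ltW]]; apply: le_trans.
rewrite ler_pdivrMl//; apply: (le_trans (kfun_le _ _ _ _)) => //.
  by rewrite mulr_ge0// ltW.
rewrite mulrDr mulrA lerD2r ler_peMl//.
by case: bX => _ [_ [n0 _ _ _] _ _] _; exact: n0.
Qed.

Lemma kfunD (R : realType) (V : topologicalLmodType R) (X : couple V)
  (t : R) (a b : V) : banach_couple X -> 0 <= t -> sumspace X a ->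
  sumspace X b -> kfun X t (a + b) <= kfun X t a + kfun X t b.
Proof.
move=> bX t0 sa sb; apply/ler_addgt0Pr => e e0.
have e2 : 0 < e / 2 by rewrite divr_gt0.
have [] := @kfun_lt _ _ X t (kfun X t a + e / 2) a bX t0 sa; first by rewrite ltrDl.
move=> a0 [a1 [Aa0 Aa1 -> /ltW ha]].
have [] := @kfun_lt _ _ X t (kfun X t b + e / 2) b bX t0 sb; first by rewrite ltrDl.
move=> b0 [b1 [Ab0 Ab1 -> /ltW hb]]; rewrite addrACA.
have [_ [[_ D0 _] [_ _ N0 _] _ _] [[_ D1 _] [_ _ N1 _] _ _]] := bX.
apply: (le_trans (kfun_le _ _ _ _)) => //; [exact: D0|exact: D1|].
have h0 := N0 _ _ Aa0 Ab0.
have := ler_wpM2l t0 (N1 _ _ Aa1 Ab1); rewrite mulrDr => h1.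
move: ha hb h0 h1; lra.
Qed.

Lemma kfunZ_le (R : realType) (V : topologicalLmodType R) (X : couple V)
  (t c : R) (a : V) : banach_couple X -> 0 <= t -> c != 0 -> sumspace X a ->
  kfun X t (c *: a) <= `|c| * kfun X t a.
Proof.
move=> bX t0 c0 sa; have nc0 : 0 < `|c| by rewrite normr_gt0.
rewrite -ler_pdivrMl//; apply/ler_addgt0Pr => e e0.
have [] := @kfun_lt _ _ X t (kfun X t a + e) a bX t0 sa; first by rewrite ltrDl.
move=> a0 [a1 [Aa0 Aa1 -> /ltW]]; apply: le_trans.
have [_ [[_ _ Z0] [_ _ _ N0] _ _] [[_ _ Z1] [_ _ _ N1] _ _]] := bX.
rewrite ler_pdivrMl// scalerDr; apply: (le_trans (kfun_le _ _ _ _)) => //.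
- exact: Z0.
- exact: Z1.
by rewrite N0// N1// mulrDr mulrCA.
Qed.

Lemma kfunZ (R : realType) (V : topologicalLmodType R) (X : couple V)
  (t c : R) (a : V) : banach_couple X -> 0 <= t -> c != 0 -> sumspace X a ->
  kfun X t (c *: a) = `|c| * kfun X t a.
Proof.
move=> bX t0 c0 sa; apply/eqP; rewrite eq_le kfunZ_le//=.
rewrite -ler_pdivlMl ?normr_gt0// -normfV.
have := @kfunZ_le _ _ X t c^-1 (c *: a) bX t0.
by rewrite scalerA mulVf// scale1r invr_eq0; apply => //; exact: sumspaceZ.
Qed.

(** Decompositions of [a] with both norms arbitrarily small exist, so by continuity of the two
    inclusions [a] lies in every neighbourhood of 0; the Hausdorff property concludes. *)
Lemma kfun_eq0 (R : realType) (V : topologicalLmodType R) (X : couple V)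
  (a : V) : banach_couple X -> sumspace X a -> kfun X 1 a = 0 -> a = 0.
Proof.
move=> bX sa Ka.
have [hV [_ [n0 _ _ _] _ c0] [_ [n1 _ _ _] _ c1]] := bX.
suff ha : forall A, nbhs (0 : V) A -> A a.
  by apply/esym/hV => A B /ha Aa /nbhs_singleton Ba; exists a.
move=> A; rewrite -{1}(addr0 0) => nA.
have := @add_continuous V (0, 0) A nA => -[[B C] /= [nB nC] BCA].
have [e [e0 Be]] := c0 _ nB; have [e' [e'0 Ce]] := c1 _ nC.
have m0 : 0 < Num.min e e' by rewrite lt_min e0.
have [] := @kfun_lt _ _ X 1 (Num.min e e') a bX ler01 sa; first by rewrite Ka.
move=> a0 [a1 [Aa0 Aa1 -> ]]; rewrite mul1r lt_min => /andP[h h'].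
apply: (BCA (a0, a1)); split => /=.
  by apply: Be => //; apply: le_lt_trans h; rewrite lerDl n1.
by apply: Ce => //; apply: le_lt_trans h'; rewrite lerDr n0.
Qed.

(** * Geometrically convergent series *)

Lemma banach_geometric_sum (R : realType) (V : topologicalLmodType R)
  (A : set V) (n : V -> R) (w : nat -> V) (c rho : R) :
  banach_in A n -> 0 <= rho -> rho < 1 ->
  (forall j, A (w j)) -> (forall j, n (w j) <= c * rho ^+ j) ->
  exists L, [/\ A L, n L <= c / (1 - rho) & forall e, 0 < e ->
    exists N, forall m, (N <= m)%N -> n (\sum_(j < m) w j - L) < e].
Proof.
move=> [sA nA cA _] rho0 rho1 Aw wle.
have [A0 AD _] := sA; have [n0 _ nD _] := nA.
pose S m := \sum_(j < m) w j; pose d := c / (1 - rho).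
have AS m : A (S m).
  by elim: m => [|m ih]; rewrite /S ?big_ord0// big_ord_recr; exact: AD.
have AB a b : A a -> A b -> A (a - b).
  by move=> Aa Ab; apply: AD => //; exact: subspaceN.
have c0 : 0 <= c.
  by rewrite (le_trans (n0 _ (Aw 0%N)))// (le_trans (wle _))// expr0 mulr1.
have r0 : 0 < 1 - rho by rewrite subr_gt0.
have d0 : 0 <= d by rewrite divr_ge0// ltW.
(* Since c = d (1 - rho), the term bounds c rho^j telescope. *)
have step m p : n (S (m + p)%N - S m) <= d * (rho ^+ m - rho ^+ (m + p)%N).
  elim: p => [|p ih]; first by rewrite addn0 !subrr mulr0 (norm0 sA nA).
  rewrite addnS {1}/S big_ord_recr/= addrAC -/(S _).
  apply: (le_trans (nD _ _ _ _)) => //; first exact: AB.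
  apply: (le_trans (lerD ih (wle _))).
  have -> : c = d * (1 - rho) by rewrite /d mulfVK// gt_eqF.
  by rewrite exprS le_eqVlt; apply/orP; left; apply/eqP; ring.
have S_le m p : (m <= p)%N -> n (S p - S m) <= d * rho ^+ m.
  move=> mp; rewrite -(subnKC mp); apply: (le_trans (step _ _)).
  by rewrite ler_wpM2l// gerBl exprn_ge0.
have tail e : 0 < e -> exists N, d * rho ^+ N < e.
  move=> e0; have /cvgrPdist_lt : geometric d rho @ \oo --> (0 : R).
    by apply: cvg_geometric; rewrite ger0_norm.
  move=> /(_ e e0) [N _ h]; exists N.
  have := h N (leqnn N); rewrite /= sub0r normrN.
  by apply: le_lt_trans; exact: ler_norm.
have decr N m : (N <= m)%N -> d * rho ^+ m <= d * rho ^+ N.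
  by move=> Nm; rewrite ler_wpM2l// ler_wiXn2l// ltW.
have [L [AL SL]] : exists L, A L /\ forall e, 0 < e ->
    exists N, forall m, (N <= m)%N -> n (S m - L) < e.
  apply: cA => // e e0; have [N hN] := tail e e0; exists N => m p Nm Np.
  wlog pm : m p Nm Np / (p <= m)%N.
    move=> hw; case/orP: (leq_total p m) => h; first exact: hw.
    by rewrite -opprB (normN nA) ?hw//; exact: AB.
  by apply: le_lt_trans hN; apply: (le_trans (S_le _ _ pm)); exact: decr.
(* The norm bound passes to the limit through L = S N - (S N - L), where n (S N) <= d. *)
exists L; split => //; apply/ler_addgt0Pr => e e0.
have [N hN] := SL e e0.
have -> : L = S N - (S N - L) by rewrite subKr.
apply: (le_trans (nD _ _ _ _)) => //; first by apply: subspaceN => //; exact: AB.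
rewrite (normN nA); last exact: AB.
rewrite lerD// ?(ltW (hN _ _))//.
by have := S_le 0%N N (leq0n _); rewrite /S big_ord0 subr0 expr0 mulr1.
Qed.

(** Here [L k] is the sum of [u j] over j < k, starting at k - 1 and going down; the decay of [B]
    towards -oo makes it geometric. It is packaged by its recursion and its bound, which is all that
    summation by parts uses. *)
Lemma banach_sum_below (R : realType) (V : topologicalLmodType R)
  (A : set V) (n : V -> R) (u : int -> V) (B : int -> R) (rho : R) :
  banach_in A n -> 0 <= rho -> rho < 1 ->
  (forall k, A (u k)) -> (forall k, n (u k) <= B k) ->
  (forall k, B (k - 1) <= rho * B k) ->
  exists L : int -> V, forall k,
    [/\ A (L k), L (k + 1) = L k + u k & n (L k) <= B (k - 1) / (1 - rho)].
Proof.
move=> bA rho0 rho1 Au uB Brho.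
have [[A0 AD _] [n0 neq0 nD _] _ _] := bA.
have [sA nA _ _] := bA.
have r0 : 0 < 1 - rho by rewrite subr_gt0.
have AB a b : A a -> A b -> A (a - b).
  by move=> Aa Ab; apply: AD => //; exact: subspaceN.
have Bj k (j : nat) : B (k - j%:Z) <= B k * rho ^+ j.
  elim: j => [|j ih]; first by rewrite subr0 expr0 mulr1.
  have -> : k - j.+1%:Z = k - j%:Z - 1 by lia.
  by rewrite (le_trans (Brho _))// exprS mulrCA ler_wpM2l.
have Bge0 k : 0 <= B k by rewrite (le_trans (n0 _ (Au k))).
have H k : exists L, [/\ A L, n L <= B (k - 1) / (1 - rho) & forall e, 0 < e ->
    exists N, forall m, (N <= m)%N ->
    n (\sum_(j < m) u (k - 1 - j%:Z) - L) < e].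
  apply: (@banach_geometric_sum _ _ A n (fun j : nat => u (k - 1 - j%:Z))) => //.
  move=> j; apply: (le_trans (uB _)).
  exact: Bj.
have [L hL] := choice H; exists L => k; have [AL nL cL] := hL k.
split => //; have [AL1 nL1 cL1] := hL (k + 1).
(* The recursion is uniqueness of limits: the difference of the two sides is shown to have norm at
   most every e > 0. *)
apply/eqP; rewrite -subr_eq0; apply/eqP; apply: neq0.
  by apply: AB => //; exact: AD.
apply/eqP; rewrite eq_le; apply/andP; split; last first.
  by apply: n0; apply: AB => //; exact: AD.
apply/ler_addgt0Pr => e e0; rewrite add0r.
have e2 : 0 < e / 2 by rewrite divr_gt0.
have [N hN] := cL _ e2; have [N1 hN1] := cL1 _ e2.
pose m := maxn N N1.
have h := hN m (leq_maxl _ _).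
(* One more term is taken at k + 1, so that the two partial sums differ exactly by [u k]. *)
have h1 := hN1 m.+1 (leqW (leq_maxr _ _)).
have AS k' m' : A (\sum_(j < m') u (k' - 1 - j%:Z)).
  by elim: m' => [|m' ih]; rewrite ?big_ord0// big_ord_recr; exact: AD.
have Sk : \sum_(j < m.+1) u (k + 1 - 1 - j%:Z) =
    u k + \sum_(j < m) u (k - 1 - j%:Z).
  rewrite big_ord_recl/=; congr (u _ + _); first by lia.
  by apply: eq_bigr => j _; congr u; rewrite /bump; lia.
have -> : L (k + 1) - (L k + u k) = (\sum_(j < m) u (k - 1 - j%:Z) - L k)
    - (\sum_(j < m.+1) u (k + 1 - 1 - j%:Z) - L (k + 1)).
  rewrite Sk; set s := \sum_(j < m) _.
  rewrite !opprB opprD [RHS]addrC -!addrA; congr (_ + _).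
  by rewrite opprD -addrA addKr addrC.
have h2 := nD _ _ (AB _ _ (AS k m) AL)
  (subspaceN sA (AB _ _ (AS (k + 1) m.+1) AL1)).
apply: (le_trans h2); rewrite (normN nA); last exact: AB.
by rewrite [e]splitr lerD// ltW.
Qed.

Lemma banach_sum_above (R : realType) (V : topologicalLmodType R)
  (A : set V) (n : V -> R) (u : int -> V) (B : int -> R) (rho : R) :
  banach_in A n -> 0 <= rho -> rho < 1 ->
  (forall k, A (u k)) -> (forall k, n (u k) <= B k) ->
  (forall k, B (k + 1) <= rho * B k) ->
  exists L : int -> V, forall k,
    [/\ A (L k), L k = L (k + 1) + u k & n (L k) <= B k / (1 - rho)].
Proof.
move=> bA rho0 rho1 Au uB Brho.
have [L hL] : exists L : int -> V, forall k, [/\ A (L k),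
    L (k + 1) = L k + u (- k) & n (L k) <= B (- (k - 1)) / (1 - rho)].
  apply: (@banach_sum_below _ _ _ _ (u \o -%R) (B \o -%R)) => // k /=;
    [exact: Au|exact: uB|by rewrite opprB addrC; exact: Brho].
(* After the reflection k -> -k, the shift by 1 turns a sum that excludes its own index into one
   over j >= k that includes it. *)
exists (fun k => L (- k + 1)) => k; have [A1 _ n1] := hL (- k + 1).
rewrite addrK opprK in n1; split => //.
have -> : - (k + 1) + 1 = - k by lia.
by have [_ -> _] := hL (- k); rewrite opprK.
Qed.

(** * Dyadic scales and the weighted multiple *)

Lemma int_stationary (T : Type) (c : int -> T) :
  (forall n, c (n + 1) = c n) -> forall n, c n = c 0.
Proof.
move=> h; elim/int_ind => [//|n ih|n ih]; first by rewrite -addn1 PoszD h.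
by rewrite -ih -[in LHS]h; congr c; lia.
Qed.

(** A real power is used so that 2^n combines with the weights 2^(- theta n) by the laws of
    [powR]. *)
Definition dyadic {R : realType} (n : int) : R := 2 `^ n%:~R.

Lemma dyadic_gt0 (R : realType) (n : int) : 0 < dyadic n :> R.
Proof. exact: powR_gt0. Qed.

Lemma dyadicD1 (R : realType) (n : int) : dyadic (n + 1) = 2 * dyadic n :> R.
Proof.
by rewrite /dyadic intrD powRD ?powRr1 1?mulrC// pnatr_eq0 implybT.
Qed.

(* With z = s_n + r_n near-optimal at scale 2^n, L_n the sum over k < n of
   (phi(k+1) - phi(k)) s_k, and R_n the sum over k >= n of
   (phi(k+1) - phi(k)) r_k, the element phi(n) z + R_n - L_n does not depend
   on n: by summation by parts it is the sum over k of phi(k) (s_k - s_(k-1)). *)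
Lemma weighted_multiple (R : realType) (V : topologicalLmodType R)
  (X : couple V) (z : V) (phi D : int -> R) (delta rho : R) :
  banach_couple X -> sumspace X z -> 0 <= delta -> 0 <= rho -> rho < 1 ->
  (forall n, 0 < phi n) ->
  (forall n, `|phi (n + 1) - phi n| <= delta * phi n) ->
  (forall n, phi n * kfun X (dyadic n) z < D n) ->
  (forall n, D (n - 1) <= rho * D n) ->
  (forall n, D (n + 1) <= rho * (2 * D n)) ->
  exists a l r, forall n : int, [/\ cA0 X (l n), cA1 X (r n),
    a = phi n *: z + (l n + r n) &
    cn0 X (l n) + dyadic n * cn1 X (r n) <= 2 * delta / (1 - rho) * D n].
Proof.
move=> bX sz delta0 rho0 rho1 phi0 dphi Kphi Ddec Dinc.
have [_ b0 b1] := bX.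
have [s0 N0 _ _] := b0; have [s1 N1 _ _] := b1.
have [A00 D0 Z0] := s0; have [A10 D1 Z1] := s1.
have [n00 _ _ nZ0] := N0; have [n10 _ _ nZ1] := N1.
have dge0 n : 0 <= dyadic n :> R by rewrite ltW// dyadic_gt0.
have D_ge0 n : 0 <= D n.
  by rewrite (le_trans _ (ltW (Kphi n)))// mulr_ge0 ?(ltW (phi0 _))// kfun_ge0.
(* The strict inequality in the hypothesis on [D] leaves the room needed to pick an actual
   decomposition below the infimum. *)
have hs' n : exists x, [/\ cA0 X x, cA1 X (z - x) &
    phi n * (cn0 X x + dyadic n * cn1 X (z - x)) <= D n].
  have h := Kphi n; rewrite mulrC -ltr_pdivlMr// in h.
  have [a0 [a1 [Aa0 Aa1 zE h']]] := kfun_lt bX (dge0 n) sz h.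
  exists a0; have -> : z - a0 = a1 by rewrite zE addrC addKr.
  by split => //; rewrite mulrC -ler_pdivlMr// ltW.
have [s hs] := choice hs'.
pose d n := phi (n + 1) - phi n.
have [L hL] : exists L : int -> V, forall k, [/\ cA0 X (L k),
    L (k + 1) = L k + d k *: s k & cn0 X (L k) <= delta * D (k - 1) / (1 - rho)].
  apply: (@banach_sum_below _ _ _ _ (fun k => d k *: s k)
    (fun k => delta * D k)) => //= k; have [As Ar h] := hs k.
  - exact: Z0.
  - rewrite nZ0//; apply: (le_trans (ler_wpM2r (n00 _ As) (dphi k))).
    rewrite -mulrA ler_wpM2l// (le_trans _ h)// ler_wpM2l ?(ltW (phi0 _))//.
    by rewrite lerDl mulr_ge0// n10.
  - by rewrite mulrCA ler_wpM2l.
(* In A1 the remainder z - s_k costs at most D k / 2^k after weighting by phi k, and the growth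
   condition on [D] says exactly that D k / 2^k decays with ratio rho. *)
have [M hM] : exists M : int -> V, forall k, [/\ cA1 X (M k),
    M k = M (k + 1) + d k *: (z - s k) &
    cn1 X (M k) <= delta * D k / dyadic k / (1 - rho)].
  apply: (@banach_sum_above _ _ _ _ (fun k => d k *: (z - s k))
    (fun k => delta * D k / dyadic k)) => //= k; have [As Ar h] := hs k.
  - exact: Z1.
  - rewrite nZ1//; apply: (le_trans (ler_wpM2r (n10 _ Ar) (dphi k))).
    rewrite ler_pdivlMr ?dyadic_gt0// -!mulrA ler_wpM2l// (le_trans _ h)//.
    rewrite ler_wpM2l ?(ltW (phi0 _))//.
    by rewrite [cn1 _ _ * _]mulrC lerDr n00.
  - rewrite dyadicD1 ler_pdivrMr ?mulr_gt0 ?dyadic_gt0//.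
    have -> : rho * (delta * D k / dyadic k) * (2 * dyadic k) =
        delta * (rho * (2 * D k)).
      by field; rewrite gt_eqF// dyadic_gt0.
    by rewrite ler_wpM2l.
(* Passing from n to n + 1 adds d n z, - d n s_n and - d n (z - s_n), which cancel. *)
pose c n := phi n *: z + (- L n + M n).
have cE n : c n = c 0.
  apply: int_stationary => {}n; rewrite /c.
  have [_ -> _] := hL n; have [_ -> _] := hM n.
  have -> : phi (n + 1) = phi n + d n by rewrite /d addrCA subrr addr0.
  rewrite scalerDl scalerBr opprD -!addrA; congr (_ + _).
  rewrite [LHS]addrCA; congr (_ + _).
  by rewrite addrA addrC.
exists (c 0), (fun n => - L n), M => n.
have [AL _ nL] := hL n; have [AM _ nM] := hM n.
split; [exact: subspaceN|by []|by rewrite -/(c n) cE|].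
rewrite (normN N0)//.
have r0 : 0 < 1 - rho by rewrite subr_gt0.
have hL2 : cn0 X (L n) <= delta * D n / (1 - rho).
  rewrite (le_trans nL)// ler_pM2r ?invr_gt0// ler_wpM2l//.
  by rewrite (le_trans (Ddec _))// ler_piMl// ltW.
have hM2 : dyadic n * cn1 X (M n) <= delta * D n / (1 - rho).
  apply: (le_trans (ler_wpM2l (dge0 n) nM)).
  by rewrite le_eqVlt; apply/orP; left; apply/eqP; field;
    rewrite !gt_eqF// ?dyadic_gt0.
apply: (le_trans (lerD hL2 hM2)).
by rewrite le_eqVlt; apply/orP; left; apply/eqP; field; rewrite gt_eqF.
Qed.

(** * Sequence norms over the integers *)

(** The enumeration 0, -1, 1, -2, 2, ... turns sums and unions over the integers into countable ones
    indexed by [nat]. *)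
Definition intenum (i : nat) : int := if odd i then Negz i./2 else Posz i./2.

Lemma intenum_bij : bijective intenum.
Proof.
exists (fun n : int => match n with Posz m => m.*2 | Negz m => m.*2.+1 end).
  by move=> i; rewrite /intenum; case: ifPn => h; lia.
move=> [m|m]; rewrite /intenum /=.
  by rewrite odd_double doubleK.
by rewrite odd_double /= uphalf_double.
Qed.

Definition lsum {R : realType} (g : int -> R) : \bar R :=
  (\sum_(i <oo) (g (intenum i))%:E)%E.

Lemma lsum_ge0 (R : realType) (g : int -> R) :
  (forall n, 0 <= g n) -> (0 <= lsum g)%E.
Proof. by move=> g0; apply: nneseries_ge0 => i _ _; rewrite lee_fin. Qed.

Lemma le_lsum (R : realType) (g h : int -> R) : (forall n, 0 <= g n) ->
  (forall n, g n <= h n) -> (lsum g <= lsum h)%E.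
Proof.
by move=> g0 gh; apply: lee_nneseries => [i _ _|i _]; rewrite lee_fin.
Qed.

Lemma lsumZ (R : realType) (c : R) (g : int -> R) : (forall n, 0 <= g n) ->
  lsum (fun n => c * g n) = (c%:E * lsum g)%E.
Proof.
move=> g0; rewrite /lsum -nneseriesZl => [|i _]; last by rewrite lee_fin.
by apply: eq_eseriesr => i _; rewrite EFinM.
Qed.

Lemma lsumD (R : realType) (g h : int -> R) : (forall n, 0 <= g n) ->
  (forall n, 0 <= h n) -> lsum (fun n => g n + h n) = (lsum g + lsum h)%E.
Proof.
by move=> g0 h0; rewrite /lsum -nneseriesD => [|i _ _|i _ _]; rewrite ?lee_fin//.
Qed.

(** The unordered sum frees [lsum] from the chosen enumeration; translation invariance and the
    comparison with a single term come from it. *)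
Lemma lsum_esum (R : realType) (g : int -> R) : (forall n, 0 <= g n) ->
  lsum g = (\esum_(n in [set: int]) (g n)%:E)%E.
Proof.
move=> g0; rewrite /lsum nneseries_esumT => [|i]; last by rewrite lee_fin.
rewrite (reindex_esum [set: nat] [set: int] intenum)//.
by rewrite setTT_bijective; exact: intenum_bij.
Qed.

Lemma lsum_reindex (R : realType) (e : int -> int) (g : int -> R) :
  bijective e -> (forall n, 0 <= g n) -> lsum (g \o e) = lsum g.
Proof.
move=> be g0; rewrite !lsum_esum//=.
by rewrite [RHS](reindex_esum [set: int] [set: int] e)// setTT_bijective.
Qed.

Lemma lsum_ge (R : realType) (g : int -> R) (n : int) : (forall n, 0 <= g n) ->
  ((g n)%:E <= lsum g)%E.
Proof.
move=> g0; rewrite lsum_esum//; apply: esum_ge; exists [set n].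
  by split => //; exact: finite_set1.
by rewrite fsbig_set1.
Qed.

Lemma lsum_geometric (R : realType) (s : R) : 0 < s ->
  (lsum (fun n => 2 `^ (- s * `|n%:~R|))%R < +oo)%E.
Proof.
move=> s0; pose x : R := 2 `^ (- (s / 2)).
have x0 : 0 <= x by exact: powR_ge0.
have x1 : x < 1.
  rewrite -(powRr0 (2 : R)) /x /powR pnatr_eq0/= ltr_expR ltr_pM2r.
    by rewrite oppr_lt0 divr_gt0.
  by rewrite ln_gt0// ltr1n.
(* Each absolute value occurs at most twice in the enumeration, so i <= 2 |intenum i| + 1 and the
   series is dominated by a geometric one of ratio 2^(- s / 2). *)
have le1 i : 2 `^ (- s * `|(intenum i)%:~R|) <= 2 `^ (s / 2) * x ^+ i :> R.
  rewrite -powR_mulrn// /x -powRrM -powRD ?pnatr_eq0 ?implybT//.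
  apply: ler_powR; first by rewrite ler1n.
  have h : i%:R <= 2 * `|(intenum i)%:~R| + 1 :> R.
    have : i%:Z <= 2 * `|intenum i| + 1.
      by rewrite /intenum; case: ifPn; lia.
    by rewrite -(ler_int R) intrD intrM intr_norm.
  nra.
apply: (@le_lt_trans _ _ (2 `^ (s / 2) * (1 - x)^-1)%:E); last exact: ltry.
apply: lime_le; first by apply: is_cvg_nneseries => i _ _; rewrite lee_fin powR_ge0.
apply: nearW => m; rewrite sumEFin lee_fin.
apply: (@le_trans _ _ (\sum_(0 <= i < m) (2 `^ (s / 2) * x ^+ i))).
  by apply: ler_sum => i _; exact: le1.
rewrite -mulr_sumr ler_wpM2l ?powR_ge0//.
have r0 : 0 < 1 - x by rewrite subr_gt0.
rewrite -[leRHS]mul1r ler_pdivlMr//.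
have -> : (\sum_(0 <= i < m) x ^+ i) * (1 - x) = 1 - x ^+ m.
  elim: m => [|m ih]; first by rewrite big_nil mul0r expr0 subrr.
  by rewrite big_nat_recr//= mulrDl ih exprS; ring.
by rewrite gerBl exprn_ge0.
Qed.

Lemma pow2_ge1 (R : realType) (x : R) : 0 <= x -> 1 <= 2 `^ x.
Proof.
by move=> x0; rewrite -[leLHS](powRr0 (2 : R)); apply: ler_powR => //; rewrite ler1n.
Qed.

Lemma pow2_le1 (R : realType) (x : R) : x <= 0 -> 2 `^ x <= 1.
Proof.
by move=> x0; rewrite -[leRHS](powRr0 (2 : R)); apply: ler_powR => //; rewrite ler1n.
Qed.

(* For f >= 0 this says that the l^q norm of f is at most M; dropping the outer
   root keeps it free of extended-real powers. At q = -oo it is a junk value. *)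
Definition lbound {R : realType} (q : \bar R) (f : int -> R) (M : R) : Prop :=
  match q with
  | r%:E => (lsum (fun n => f n `^ r)%R <= (M `^ r)%:E)%E
  | _ => forall n, f n <= M
  end.

Lemma le_lbound (R : realType) (q : \bar R) (f g : int -> R) (M : R) :
  (1 <= q)%E -> (forall n, 0 <= f n) -> (forall n, f n <= g n) ->
  lbound q g M -> lbound q f M.
Proof.
case: q => [r||] //= r1 f0 fg; last by move=> h n; exact: le_trans (h n).
move: r1; rewrite lee_fin => r1; apply: le_trans; apply: le_lsum => n.
  exact: powR_ge0.
have gn0 : 0 <= g n := le_trans (f0 n) (fg n).
by apply: ge0_ler_powR; rewrite ?nnegrE//; exact: le_trans r1.
Qed.

Lemma lbound_le (R : realType) (q : \bar R) (f : int -> R) (M N : R) :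
  (1 <= q)%E -> 0 <= M -> M <= N -> lbound q f M -> lbound q f N.
Proof.
case: q => [r||] //= r1 M0 MN h; last by move=> n; exact: le_trans (h n) MN.
apply: (le_trans h); rewrite lee_fin; move: r1; rewrite lee_fin => r1.
have N0 : 0 <= N := le_trans M0 MN.
by apply: ge0_ler_powR; rewrite ?nnegrE//; exact: le_trans r1.
Qed.

Lemma lboundZ (R : realType) (q : \bar R) (f : int -> R) (c M : R) :
  (1 <= q)%E -> 0 <= c -> 0 <= M -> (forall n, 0 <= f n) -> lbound q f M ->
  lbound q (fun n => c * f n) (c * M).
Proof.
case: q => [r||] //= r1 c0 M0 f0 h; last by move=> n; rewrite ler_wpM2l.
rewrite (_ : (fun n => _) = (fun n => c `^ r * f n `^ r)); last first.
  by apply/funext => n; rewrite powRM.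
rewrite lsumZ => [|n]; last exact: powR_ge0.
by rewrite powRM// EFinM lee_wpmul2l// lee_fin powR_ge0.
Qed.

(** The elementary bound (f + g)^r <= (2 max(f, g))^r <= 2^r (f^r + g^r) replaces Minkowski's
    inequality. One factor 2 of the constant comes from it, the other from 2 <= 2^r. *)
Lemma lboundD (R : realType) (q : \bar R) (f g : int -> R) (M : R) :
  (1 <= q)%E -> 0 <= M -> (forall n, 0 <= f n) -> (forall n, 0 <= g n) ->
  lbound q f M -> lbound q g M -> lbound q (fun n => f n + g n) (4 * M).
Proof.
case: q => [r||] //= r1 M0 f0 g0 hf hg; last first.
  by move=> n; have := hf n; have := hg n; lra.
move: r1; rewrite lee_fin => r1; have r0 : 0 <= r by exact: le_trans r1.
have le2 n : (f n + g n) `^ r <= 2 `^ r * (f n `^ r + g n `^ r).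
  have m0 : 0 <= Num.max (f n) (g n) by rewrite le_max f0.
  apply: (@le_trans _ _ (2 `^ r * Num.max (f n) (g n) `^ r)).
    rewrite -powRM//; apply: ge0_ler_powR => //; rewrite ?nnegrE ?addr_ge0//.
      by rewrite mulr_ge0.
    by rewrite mulr2n mulrDl mul1r lerD// le_max lexx ?orbT.
  rewrite ler_wpM2l ?powR_ge0// maxEle; case: ifP => _.
    by rewrite lerDr powR_ge0.
  by rewrite lerDl powR_ge0.
apply: (le_trans (le_lsum _ le2)) => [n|]; first exact: powR_ge0.
rewrite lsumZ => [|n]; last by rewrite addr_ge0 ?powR_ge0.
rewrite lsumD => [|n|n]; rewrite ?powR_ge0//.
apply: (@le_trans _ _ ((2 `^ r)%:E * ((M `^ r)%:E + (M `^ r)%:E))%E).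
  by apply: lee_wpmul2l; rewrite ?lee_fin ?powR_ge0//; exact: leeD.
rewrite -EFinD -EFinM lee_fin.
have -> : 4 * M = 2 * (2 * M) by ring.
rewrite powRM ?mulr_ge0// ler_wpM2l ?powR_ge0// powRM//.
by rewrite -mulr2n -[_ *+ 2]mulr_natl ler_wpM2r ?powR_ge0// le1r_powR// ler1n.
Qed.

Lemma lbound_ge (R : realType) (q : \bar R) (f : int -> R) (M : R) (n : int) :
  (1 <= q)%E -> 0 <= M -> (forall n, 0 <= f n) -> lbound q f M -> f n <= M.
Proof.
case: q => [r||] //= r1 M0 f0 h.
move: r1; rewrite lee_fin => r1; have r0 : 0 < r by exact: lt_le_trans r1.
have := le_trans (@lsum_ge _ (fun n => f n `^ r) n (fun n => powR_ge0 _ _)) h.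
rewrite lee_fin; apply: contraTle => hM.
by rewrite -ltNge; apply: gt0_ltr_powR; rewrite ?nnegrE.
Qed.

(* For finite q the majorant is the weighted norm
   F n = (\sum_k (2^(- eta |n - k|) f k)^q)^(1/q). *)
Lemma lbound_majorant (R : realType) (q : \bar R) (eta : R) :
  (1 <= q)%E -> 0 < eta -> exists2 C, 0 < C & forall (f : int -> R) M,
  0 <= M -> (forall n, 0 <= f n) -> lbound q f M ->
  exists F : int -> R, [/\ forall n, f n <= F n,
    forall n k, F k <= 2 `^ (eta * `|(n - k)%:~R|) * F n
    & lbound q F (C * M)].
Proof.
case: q => [r||] //= r1 eta0; last first.
  exists 1 => // f M M0 f0 fM; exists (fun=> M); split => //= n.
    by move=> k; rewrite ler_peMl// pow2_ge1// mulr_ge0// ltW.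
  by rewrite mul1r.
move: r1; rewrite lee_fin => r1; have r0 : 0 < r by exact: lt_le_trans r1.
pose om (n k : int) : R := 2 `^ (- eta * `|(n - k)%:~R|).
pose W := fine (lsum (fun n => 2 `^ (- (eta * r) * `|n%:~R|))%R).
have s0 : 0 < eta * r by rewrite mulr_gt0.
(* By translation invariance the total mass of the kernel does not depend on k. *)
have WE k : lsum (fun n => om n k `^ r)%R = W%:E.
  rewrite /W fineK; last first.
    rewrite ge0_fin_numE; first exact: lsum_geometric.
    by apply: lsum_ge0 => n; exact: powR_ge0.
  rewrite -[RHS](@lsum_reindex _ (fun n => n - k)) => [||n]; rewrite ?powR_ge0//.
    by congr lsum; apply/funext => n /=; rewrite /om -powRrM !mulNr mulrAC.
  by exists (fun n => n + k) => n; rewrite ?subrK ?addrK.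
have W0 : 0 <= W.
  by rewrite fine_ge0//; apply: lsum_ge0 => n; exact: powR_ge0.
(* The sharp constant is W^(1/r); adding 1 makes positivity immediate. *)
exists ((W + 1) `^ r^-1); first by rewrite powR_gt0// ltr_wpDl.
move=> f M M0 f0 fM.
have g0 n k : 0 <= (om n k * f k) `^ r by exact: powR_ge0.
pose G n := lsum (fun k => (om n k * f k) `^ r)%R.
have om1 n k : om n k <= 1.
  by rewrite pow2_le1// mulNr oppr_le0 mulr_ge0// ltW.
have GM n : (G n <= (M `^ r)%:E)%E.
  apply: le_trans fM; apply: le_lsum => // k.
  apply: ge0_ler_powR; rewrite ?nnegrE ?mulr_ge0 ?powR_ge0 ?(ltW r0)//.
  by rewrite ler_piMl.
have G0 n : (0 <= G n)%E by exact: lsum_ge0.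
have GE n : G n = (fine (G n))%:E.
  by rewrite fineK// ge0_fin_numE// (le_lt_trans (GM n))// ltry.
pose F n := fine (G n) `^ r^-1.
have FE n : F n `^ r = fine (G n).
  by rewrite /F -powRrM mulVf ?gt_eqF// powRr1// fine_ge0.
have F0 n : 0 <= F n by exact: powR_ge0.
have cancel a b : 0 <= a -> 0 <= b -> a `^ r <= b `^ r -> a <= b :> R.
  move=> a0 b0; apply: contraTle => ba.
  by rewrite -ltNge; apply: gt0_ltr_powR; rewrite ?nnegrE.
exists F; split.
- move=> n; apply: cancel => //; rewrite FE -lee_fin -(GE n).
  have := @lsum_ge _ (fun k => (om n k * f k) `^ r)%R n (g0 n).
  by rewrite {1}/om subrr normr0 mulr0 powRr0 mul1r.
- move=> n k; apply: cancel => //; first by rewrite mulr_ge0 ?powR_ge0.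
  rewrite FE (powRM _ (powR_ge0 _ _) (F0 n)) FE.
  rewrite -lee_fin -(GE k) EFinM -(GE n).
  rewrite /G -lsumZ//.
  apply: le_lsum => // j; rewrite -powRM ?mulr_ge0 ?powR_ge0//.
  apply: ge0_ler_powR; rewrite ?nnegrE ?mulr_ge0 ?powR_ge0 ?(ltW r0)//.
  rewrite mulrA ler_wpM2r// -powRD ?pnatr_eq0 ?implybT// ler_powR ?ler1n//.
  (* Slow variation of F is the triangle inequality in the exponent of the kernel. *)
  have h : `|(n - j)%:~R| <= `|(k - j)%:~R| + `|(n - k)%:~R| :> R.
    have -> : n - j = (k - j) + (n - k) by lia.
    by rewrite intrD; exact: ler_normD.
  have := ler_wpM2l (ltW eta0) h; rewrite mulrDr !mulNr.
  set x := eta * _; set y := eta * _; set w := eta * _; lra.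
rewrite (_ : (fun n => F n `^ r) = fine \o G); last by apply/funext.
rewrite powRM ?powR_ge0// -powRrM mulVf ?gt_eqF// powRr1 ?addr_ge0//.
apply: (@le_trans _ _ (W%:E * (M `^ r)%:E)%E); last first.
  by rewrite -EFinM lee_fin ler_wpM2r ?powR_ge0// lerDl.
(* Interchanging the two sums leaves, for each k, f k^r times the mass W of the kernel. *)
apply: (@le_trans _ _ (W%:E * lsum (fun k => f k `^ r)%R)%E); last first.
  by rewrite lee_wpmul2l.
rewrite /lsum -nneseriesZl => [|i _]; last by rewrite lee_fin powR_ge0.
under eq_eseriesr => i _ do rewrite /= -(GE (intenum i)).
rewrite /G /lsum nneseries_interchange//; last by move=> i j; rewrite lee_fin.
apply: lee_nneseries => [i _ _|i _].
  by apply: nneseries_ge0 => j _ _; rewrite lee_fin.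
set k := intenum i.
under eq_eseriesr => j _ do rewrite powRM ?powR_ge0// mulrC.
rewrite -/(lsum (fun n => f k `^ r * om n k `^ r)%R).
by rewrite lsumZ => [|n]; rewrite ?powR_ge0// WE muleC.
Qed.

(** * Discretization of the interpolation norm *)

Lemma dyadic_floor (R : realType) (t : R) : 0 < t ->
  exists n : int, dyadic n <= t < dyadic (n + 1).
Proof.
move=> t0; have l2 : 0 < ln (2 : R) by rewrite ln_gt0// ltr1n.
have tE : t = 2 `^ (ln t / ln 2).
  by rewrite /powR pnatr_eq0/= divfK ?gt_eqF// lnK.
exists (Num.floor (ln t / ln 2)).
have /andP[h1 h2] := floor_itv (ln t / ln 2).
rewrite {2 3}tE /dyadic /powR !pnatr_eq0/= ler_expR ltr_expR.
by rewrite ler_pM2r// ltr_pM2r// h1.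
Qed.

Lemma dyadic_inj_itv (R : realType) (t : R) (m n : int) :
  dyadic m <= t < dyadic (m + 1) -> dyadic n <= t < dyadic (n + 1) -> m = n.
Proof.
have l2 : 0 < ln (2 : R) by rewrite ln_gt0// ltr1n.
have lt i j : dyadic i < dyadic j :> R -> i < j.
  by rewrite /dyadic /powR pnatr_eq0/= ltr_expR ltr_pM2r// ltr_int.
move=> /andP[m1 m2] /andP[n1 n2].
have := lt _ _ (le_lt_trans m1 n2); have := lt _ _ (le_lt_trans n1 m2); lia.
Qed.

Definition dyadic_itv {R : realType} (n : int) : set R :=
  `[dyadic n, dyadic (n + 1)[%classic.

Lemma measure_dyadic_itv (R : realType) (n : int) :
  lebesgue_measure (dyadic_itv n : set R) = (dyadic n)%:E.
Proof.
rewrite /dyadic_itv lebesgue_measure_itv/= dyadicD1 lte_fin.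
by rewrite ltr_pMl ?dyadic_gt0// ltr1n -EFinB; congr EFin; ring.
Qed.

Lemma integral_dyadic (R : realType) (g : R -> R) :
  measurable_fun [set: R] g -> (forall t, 0 < t -> 0 <= g t) ->
  (\int[lebesgue_measure]_(t in `]0%R, +oo[) (g t)%:E =
   \sum_(i <oo) \int[lebesgue_measure]_(t in dyadic_itv (intenum i)) (g t)%:E)%E.
Proof.
move=> mg g0.
have DE : `]0%R, +oo[%classic = \bigcup_i (dyadic_itv (intenum i) : set R).
  apply/seteqP; split => [t /=|t [i _] /=]; rewrite /dyadic_itv/= !in_itv/= andbT.
    move=> /dyadic_floor[n hn]; have [e _ en] := intenum_bij.
    by exists (e n); rewrite // en /dyadic_itv /= in_itv.
  by move=> /andP[+ _]; apply: lt_le_trans; exact: dyadic_gt0.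
rewrite DE ge0_integral_bigcup//.
- by move=> k; exact: measurable_itv.
- by apply/measurable_EFinP; exact: measurable_funTS.
- by move=> t; rewrite -DE/= in_itv/= andbT lee_fin; exact: g0.
- apply/trivIsetP => i j _ _ ij; apply/seteqP; split => // t []; rewrite /dyadic_itv/=.
  rewrite !in_itv/= => h1 h2; have := dyadic_inj_itv h1 h2.
  by move=> /(bij_inj intenum_bij) => E; rewrite E eqxx in ij.
Qed.

(** The l^q norm of this sequence is equivalent to the interpolation norm ([lbound_disc],
    [interp_norm_le]); all later estimates are made on it. *)
Definition disc {R : realType} {V : topologicalLmodType R} (X : couple V)
  (theta : R) (a : V) (n : int) : R :=
  2 `^ (- theta * n%:~R) * kfun X (dyadic n) a.

Lemma disc_ge0 (R : realType) (V : topologicalLmodType R) (X : couple V)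
  (theta : R) (a : V) (n : int) : banach_couple X -> 0 <= disc X theta a n.
Proof. by move=> bX; rewrite mulr_ge0 ?powR_ge0 ?kfun_ge0// ltW// dyadic_gt0. Qed.

Lemma discE (R : realType) (V : topologicalLmodType R) (X : couple V)
  (theta : R) (a : V) (n : int) :
  disc X theta a n = dyadic n `^ (- theta) * kfun X (dyadic n) a.
Proof. by rewrite /disc /dyadic -powRrM mulrC [_ * - theta]mulrC mulrC. Qed.

(** Across one dyadic interval K increases and at most doubles, while t^(- theta) decreases by at
    most the factor 2^(- theta). *)
Lemma disc_bounds (R : realType) (V : topologicalLmodType R) (X : couple V)
  (theta t : R) (a : V) (n : int) : banach_couple X -> 0 <= theta ->
  sumspace X a -> dyadic n <= t < dyadic (n + 1) ->
  2 `^ (- theta) * disc X theta a n <= t `^ (- theta) * kfun X t a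
    <= 2 * disc X theta a n.
Proof.
move=> bX th0 sa /andP[nt tn]; have d0 := dyadic_gt0 R n.
have t0 : 0 < t := lt_le_trans d0 nt.
have hp (x y : R) : 0 < x -> x <= y -> y `^ (- theta) <= x `^ (- theta).
  move=> x0 xy; rewrite !powRN lef_pV2 ?posrE ?powR_gt0 ?(lt_le_trans x0)//.
  by apply: ge0_ler_powR; rewrite ?nnegrE ?(ltW x0)// ltW// (lt_le_trans x0).
rewrite discE; apply/andP; split.
  rewrite mulrA -powRM ?(ltW d0)// -dyadicD1.
  apply: ler_pM; rewrite ?powR_ge0 ?kfun_ge0 ?(ltW d0)//.
    by apply: hp => //; exact: ltW.
  by apply: ler_kfun => //; exact: ltW.
rewrite mulrCA; apply: ler_pM; rewrite ?powR_ge0 ?kfun_ge0 ?(ltW t0)//.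
  exact: hp.
apply: (@le_trans _ _ (kfun X (dyadic (n + 1)) a)).
  by apply: ler_kfun => //; exact: ltW.
by rewrite dyadicD1 kfun_scale_le ?(ltW d0)// ler1n.
Qed.

(** On each dyadic interval the previous bounds apply, and t^-1 cancels the length 2^n up to a
    factor 2, whence the 2^-1 in the lower constant. *)
Lemma integral_interp_bounds (R : realType) (V : topologicalLmodType R)
  (X : couple V) (theta r : R) (a : V) :
  banach_couple X -> 0 <= theta -> 1 <= r -> sumspace X a ->
  let I := (\int[lebesgue_measure]_(t in `]0%R, +oo[)
    (((t `^ (- theta))%:E * Kfun X t a) `^ r * (t^-1)%:E))%E in
  ((2^-1 * (2 `^ (- theta)) `^ r)%:E * lsum (fun n => disc X theta a n `^ r)%R
     <= I)%E /\
  (I <= (2 `^ r)%:E * lsum (fun n => disc X theta a n `^ r)%R)%E.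
Proof.
move=> bX th0 r1 sa I; have r0 : 0 <= r by exact: le_trans r1.
(* Cutting off at 0 gives a function nondecreasing on the whole line, hence measurable. *)
pose k (t : R) := if 0 < t then kfun X t a else 0.
pose g (t : R) := (t `^ (- theta) * k t) `^ r * t `^ (-1).
have nd_k : nondecreasing_fun k.
  move=> s t st; rewrite /k; case: ifPn => s0; last first.
    by case: ifPn => // t0; rewrite kfun_ge0// ltW.
  by rewrite (lt_le_trans s0 st); apply: ler_kfun => //; exact: ltW.
have mg : measurable_fun [set: R] g.
  apply: measurable_funM; last exact: measurable_powR.
  apply: (measurableT_comp (measurable_powR r)).
  apply: measurable_funM; first exact: measurable_powR.
  exact: nondecreasing_measurable.
have g0 t : 0 < t -> 0 <= g t by move=> _; rewrite mulr_ge0 ?powR_ge0.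
have IE : I = (\int[lebesgue_measure]_(t in `]0%R, +oo[) (g t)%:E)%E.
  apply: eq_integral => t; rewrite inE/= in_itv/= andbT => t0.
  rewrite KfunE ?(ltW t0)// -[((t `^ (- theta))%:E * _)%E]EFinM poweR_EFin.
  rewrite -EFinM /g /k t0.
  by rewrite powR_inv1// ltW.
have mJ n : measurable (dyadic_itv n : set R) by exact: measurable_itv.
have mgJ n : measurable_fun (dyadic_itv n : set R) (EFin \o g).
  by apply/measurable_EFinP; exact: measurable_funTS.
have d0 n : 0 <= disc X theta a n by exact: disc_ge0.
have bnd n t : dyadic_itv n t ->
    (2 `^ (- theta) * disc X theta a n) `^ r / (2 * dyadic n) <= g t
      <= (2 * disc X theta a n) `^ r / dyadic n.
  rewrite /dyadic_itv/= in_itv/= => nt; have /andP[h1 h2] := nt.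
  have t0 : 0 < t := lt_le_trans (dyadic_gt0 _ _) h1.
  have /andP[b1 b2] := disc_bounds bX th0 sa nt.
  have m0 : 0 <= t `^ (- theta) * kfun X t a.
    by rewrite mulr_ge0 ?powR_ge0 ?kfun_ge0// ltW.
  rewrite /g /k t0 powR_inv1 ?(ltW t0)// -dyadicD1.
  apply/andP; split; apply: ler_pM; rewrite ?powR_ge0 ?invr_ge0 ?(ltW t0)//.
  - by rewrite ltW// dyadic_gt0.
  - by apply: ge0_ler_powR => //; rewrite nnegrE mulr_ge0 ?powR_ge0.
  - by rewrite lef_pV2 ?posrE ?dyadic_gt0// ltW.
  - by apply: ge0_ler_powR => //; rewrite nnegrE mulr_ge0.
  - by rewrite lef_pV2 ?posrE ?dyadic_gt0.
have lo n : ((2^-1 * (2 `^ (- theta)) `^ r * disc X theta a n `^ r)%:E <=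
    \int[lebesgue_measure]_(t in dyadic_itv n) (g t)%:E)%E.
  pose c := (2 `^ (- theta) * disc X theta a n) `^ r / (2 * dyadic n).
  have c0 : 0 <= c.
    by rewrite divr_ge0 ?powR_ge0// mulr_ge0// ltW// dyadic_gt0.
  have -> : 2^-1 * (2 `^ (- theta)) `^ r * disc X theta a n `^ r = c * dyadic n.
    rewrite /c powRM ?powR_ge0//; field.
    by rewrite gt_eqF// dyadic_gt0.
  rewrite EFinM -measure_dyadic_itv -integral_cst; last exact: mJ.
  apply: ge0_le_integral => //.
  - exact: mJ.
  - exact: mgJ.
  - by move=> t /bnd/andP[h _]; rewrite lee_fin.
have hi n : (\int[lebesgue_measure]_(t in dyadic_itv n) (g t)%:E <=
    (2 `^ r * disc X theta a n `^ r)%:E)%E.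
  pose c := (2 * disc X theta a n) `^ r / dyadic n.
  have -> : 2 `^ r * disc X theta a n `^ r = c * dyadic n.
    by rewrite /c -powRM// divfK// gt_eqF// dyadic_gt0.
  rewrite EFinM -measure_dyadic_itv -integral_cst; last exact: mJ.
  apply: ge0_le_integral => //.
  - exact: mJ.
  - by move=> t _; rewrite lee_fin mulr_ge0 ?powR_ge0.
  - exact: mgJ.
  - by move=> t /bnd/andP[_ h]; rewrite lee_fin.
have dr n : 0 <= disc X theta a n `^ r by exact: powR_ge0.
rewrite IE integral_dyadic// -!(lsumZ _ dr).
split; apply: lee_nneseries => [i _ _|i _].
- by rewrite lee_fin mulr_ge0 ?mulr_ge0 ?powR_ge0// invr_ge0.
- exact: lo.
- by apply: integral_ge0 => t _; rewrite lee_fin mulr_ge0 ?powR_ge0.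
- exact: hi.
Qed.

Lemma lbound_disc (R : realType) (V : topologicalLmodType R) (X : couple V)
  (theta M : R) (q : \bar R) (a : V) :
  banach_couple X -> 0 <= theta -> (1 <= q)%E -> sumspace X a -> 0 <= M ->
  (interp_norm X theta q a <= M%:E)%E ->
  lbound q (disc X theta a) (2 * 2 `^ theta * M).
Proof.
move=> bX th0; have p1 : 1 <= 2 `^ theta :> R by exact: pow2_ge1.
case: q => [r||] //= r1 sa M0; last first.
  move=> h n; apply: (@le_trans _ _ M); last by rewrite ler_peMl//; nra.
  rewrite discE -lee_fin EFinM -KfunE ?(ltW (dyadic_gt0 _ _))//.
  apply: le_trans h; apply: ereal_sup_ubound.
  by exists (dyadic n); split => //; exact: dyadic_gt0.
move: r1; rewrite lee_fin => r1; have r0 : 0 < r by exact: lt_le_trans r1.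
have [] := integral_interp_bounds bX th0 r1 sa.
set I := (\int[_]_(_ in _) _)%E => lo _ h.
have I0 : (0 <= I)%E.
  apply: le_trans lo; apply: mule_ge0.
    by rewrite lee_fin mulr_ge0 ?powR_ge0// invr_ge0.
  by apply: lsum_ge0 => n; exact: powR_ge0.
have IM : (I <= (M `^ r)%:E)%E.
  have := @gt0_ler_poweR R r (ltW r0) _ _ _ _ h.
  rewrite -poweRrM mulVf ?gt_eqF// poweRe1// poweR_EFin; apply.
    by rewrite in_itv/= leey poweR_ge0.
  by rewrite in_itv/= leey lee_fin M0.
pose c : R := 2^-1 * (2 `^ (- theta)) `^ r.
have c0 : 0 < c by rewrite mulr_gt0 ?powR_gt0// invr_gt0.
(* Here c^-1 = 2 (2^theta)^r, and 2 <= 2^r since r >= 1, so the factor 2 can be absorbed under the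
   power r. *)
apply: (@le_trans _ _ (c^-1 * M `^ r)%:E).
  by rewrite EFinM lee_pdivlMl// (le_trans lo).
rewrite lee_fin -mulrA powRM ?mulr_ge0 ?powR_ge0// powRM ?powR_ge0//.
have -> : c = 2^-1 * ((2 `^ theta) `^ r)^-1.
  by rewrite /c -[in LHS]powRrM mulNr powRN powRrM.
rewrite mulrA ler_wpM2r ?powR_ge0// invfM !invrK ler_wpM2r ?powR_ge0//.
by rewrite le1r_powR// ler1n.
Qed.

Lemma interp_norm_le (R : realType) (V : topologicalLmodType R) (X : couple V)
  (theta M : R) (q : \bar R) (a : V) :
  banach_couple X -> 0 <= theta -> (1 <= q)%E -> sumspace X a -> 0 <= M ->
  lbound q (disc X theta a) M -> (interp_norm X theta q a <= (2 * M)%:E)%E.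
Proof.
move=> bX th0; case: q => [r||] //= r1 sa M0 h; last first.
  apply: ge_ereal_sup => _ [t [t0 ->]]; have [n nt] := dyadic_floor t0.
  rewrite KfunE ?(ltW t0)// -EFinM lee_fin.
  have /andP[_ /le_trans] := disc_bounds bX th0 sa nt; apply.
  by rewrite ler_wpM2l.
move: r1; rewrite lee_fin => r1; have r0 : 0 < r by exact: lt_le_trans r1.
have [] := integral_interp_bounds bX th0 r1 sa.
set I := (\int[_]_(_ in _) _)%E => lo hi.
have I0 : (0 <= I)%E.
  apply: le_trans lo; apply: mule_ge0.
    by rewrite lee_fin mulr_ge0 ?powR_ge0// invr_ge0.
  by apply: lsum_ge0 => n; exact: powR_ge0.
have IM : (I <= ((2 * M) `^ r)%:E)%E.
  apply: (le_trans hi); rewrite powRM// EFinM; apply: lee_wpmul2l; last exact: h.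
  by rewrite lee_fin powR_ge0.
have -> : (2 * M)%:E = (((2 * M) `^ r)%:E `^ r^-1)%E.
  by rewrite poweR_EFin -powRrM mulfV ?gt_eqF// powRr1// mulr_ge0.
apply: gt0_ler_poweR => //; first by rewrite invr_ge0 ltW.
  by rewrite in_itv/= leey I0.
by rewrite in_itv/= leey lee_fin powR_ge0.
Qed.

(** * Stability of the inverse *)

Lemma interp_space_lbound (R : realType) (V : topologicalLmodType R)
  (X : couple V) (theta : R) (q : \bar R) (a : V) :
  banach_couple X -> 0 <= theta -> (1 <= q)%E -> interp_space X theta q a ->
  exists2 M, 0 <= M & lbound q (disc X theta a) M.
Proof.
move=> bX th0 q1 [sa na].
have [M M0 h] : exists2 M : R, 0 <= M & (interp_norm X theta q a <= M%:E)%E.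
  case: (interp_norm X theta q a) na => [m _|//|_].
    exists (Num.max m 0); first by rewrite le_max lexx orbT.
    by rewrite lee_fin le_max lexx.
  by exists 0 => //; exact: leNye.
exists (2 * 2 `^ theta * M); first by rewrite !mulr_ge0 ?powR_ge0.
exact: lbound_disc.
Qed.

Lemma lbound_interp_space (R : realType) (V : topologicalLmodType R)
  (X : couple V) (theta M : R) (q : \bar R) (a : V) :
  banach_couple X -> 0 <= theta -> (1 <= q)%E -> sumspace X a -> 0 <= M ->
  lbound q (disc X theta a) M -> interp_space X theta q a.
Proof.
move=> bX th0 q1 sa M0 h; split => //.
by apply: (le_lt_trans (interp_norm_le bX th0 q1 sa M0 h)); exact: ltry.
Qed.

Lemma bounded_between_norm (R : realType) (U W : topologicalLmodType R)
  (A : set U) (nA : U -> R) (B : set W) (nB : W -> R) (T : U -> W) :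
  is_norm_on A nA -> bounded_between A nA B nB T ->
  exists2 C, 0 <= C & forall a, A a -> nB (T a) <= C * nA a.
Proof.
move=> [n0 _ _ _] [_ [C hC]]; exists `|C| => // a Aa.
by rewrite (le_trans (hC _ Aa))// ler_wpM2r ?n0// ler_norm.
Qed.

(** The constant B is fixed before z, phi, delta and M. Choosing delta small compared with 1 / B
    therefore improves any bound M by a fixed factor, and the improvement can be iterated. *)
Lemma kernel_contraction (R : realType) (U W : topologicalLmodType R)
  (X : couple U) (Y : couple W) (T : U -> W) (q : \bar R) (theta : R) :
  banach_couple X -> banach_couple Y -> (1 <= q)%E -> couple_operator X Y T ->
  0 < theta -> theta < 1 ->
  (exists C : R, forall x, interp_space X theta q x ->
    (interp_norm X theta q x <= C%:E * interp_norm Y theta q (T x))%E) ->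
  exists2 B, 0 <= B & forall (z : U) (phi : int -> R) (delta M : R),
  sumspace X z -> T z = 0 -> 0 < kfun X 1 z -> 0 <= delta -> 0 <= M ->
  (forall n, 0 < phi n) ->
  (forall n, `|phi (n + 1) - phi n| <= delta * phi n) ->
  lbound q (fun n => phi n * disc X theta z n) M ->
  lbound q (fun n => phi n * disc X theta z n) (B * delta * M).
Proof.
move=> bX bY q1 [[TD TZ] T0 T1] th0 th1 [C hC].
have [_ [s0 N0 _ _] [s1 N1 _ _]] := bX.
have [C0 C00 hC0] := bounded_between_norm N0 T0.
have [C1 C10 hC1] := bounded_between_norm N1 T1.
have [n00 _ _ _] := N0; have [n10 _ _ _] := N1.
pose CT := C0 + C1; have CT0 : 0 <= CT by rewrite addr_ge0.
(* This rate lies below both theta and 1 - theta, so a majorant F varying by at most 2^eta per step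
   keeps 2^(theta n) F n geometric towards -oo and 2^((theta - 1) n) F n geometric towards +oo. The
   two ratios are those in [rho]. *)
pose eta := theta * (1 - theta).
have eta0 : 0 < eta by rewrite mulr_gt0// subr_gt0.
have [Cm Cm0 major] := lbound_majorant q1 eta0.
pose rho : R := Num.max (2 `^ (eta - theta)) (2 `^ (theta + eta - 1)).
have pow2_lt1 (x : R) : x < 0 -> 2 `^ x < 1.
  move=> x0; rewrite /powR pnatr_eq0/= expR_lt1 pmulr_llt0// ln_gt0//.
  by rewrite ltr1n.
have rho0 : 0 <= rho by rewrite le_max powR_ge0.
have rho1 : rho < 1 by rewrite gt_max !pow2_lt1// /eta; nra.
have r0 : 0 < 1 - rho by rewrite subr_gt0.
(* The factor 2 / (1 - rho) of [weighted_multiple] times the factor 2 in the definition of [D]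
   below. *)
pose A := 4 / (1 - rho); have A0 : 0 <= A by rewrite divr_ge0// ltW.
have AE : A = 4 / (1 - rho) by [].
clearbody A.
pose B1 := 2 * 2 `^ theta * (`|C| * (2 * (CT * A * Cm))).
have B10 : 0 <= B1.
  by rewrite !mulr_ge0 ?powR_ge0 ?(ltW Cm0).
have B1E : B1 = 2 * 2 `^ theta * (`|C| * (2 * (CT * A * Cm))) by [].
clearbody B1.
have ACm0 : 0 <= A * Cm by rewrite mulr_ge0// ltW.
exists (4 * (B1 + A * Cm)); first by rewrite mulr_ge0// addr_ge0.
move=> z phi delta M sz Tz Kz delta0 M0 phi0 dphi fM.
have dge0 n : 0 <= dyadic n :> R by rewrite ltW// dyadic_gt0.
pose f n := phi n * disc X theta z n.
have f0 n : 0 <= f n by rewrite mulr_ge0 ?(ltW (phi0 n))// disc_ge0.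
have [F [fF Fslow FM]] := major _ _ M0 f0 fM.
have p0 (x : R) : 0 < 2 `^ x by exact: powR_gt0.
have pD (x y : R) : 2 `^ (x + y) = 2 `^ x * 2 `^ y.
  by rewrite powRD// pnatr_eq0 implybT.
(* Positivity at 0 comes from K(1, z) > 0 and spreads by slow variation. With the factor 2 in [D] it
   gives the strict inequality [Dphi]. *)
have Fgt0 n : 0 < F n.
  have F00 : 0 < F 0.
    apply: lt_le_trans (fF 0); rewrite /f mulr_gt0// /disc mulr_gt0//.
    by rewrite /dyadic powRr0.
  by have := lt_le_trans F00 (Fslow n 0); rewrite pmulr_rgt0.
pose D n := 2 * (2 `^ (theta * n%:~R) * F n).
have fE n : phi n * kfun X (dyadic n) z = 2 `^ (theta * n%:~R) * f n.
  by rewrite /f /disc mulNr powRN; field; rewrite gt_eqF.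
have Dphi n : phi n * kfun X (dyadic n) z < D n.
  rewrite fE /D.
  have h : 2 `^ (theta * n%:~R) * f n <= 2 `^ (theta * n%:~R) * F n.
    by rewrite ler_wpM2l// ltW.
  have : 0 < 2 `^ (theta * n%:~R) * F n by rewrite mulr_gt0.
  lra.
have Ddec n : D (n - 1) <= rho * D n.
  rewrite /D [leRHS]mulrCA ler_pM2l// intrB mulrBr mulr1 pD.
  have := Fslow n (n - 1).
  rewrite subKr normr1 mulr1 => h.
  apply: (@le_trans _ _ (2 `^ (theta * n%:~R) * 2 `^ (- theta) *
    (2 `^ eta * F n))); first by rewrite ler_wpM2l// mulr_ge0 ?ltW.
  have hr : 2 `^ (- theta) * 2 `^ eta <= rho.
    by rewrite -pD addrC /rho le_max lexx.
  have h2 : 0 <= 2 `^ (theta * n%:~R) * F n by rewrite mulr_ge0// ltW.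
  have := ler_wpM2r h2 hr.
  set x := 2 `^ (theta * n%:~R); set y := 2 `^ (- theta); set w := 2 `^ eta.
  by have -> : x * y * (w * F n) = y * w * (x * F n) by ring.
have Dinc n : D (n + 1) <= rho * (2 * D n).
  rewrite /D [leRHS]mulrCA ler_pM2l// intrD mulrDr mulr1 pD.
  have := Fslow n (n + 1).
  rewrite opprD addrA subrr add0r normrN1 mulr1 => h.
  apply: (@le_trans _ _ (2 `^ (theta * n%:~R) * 2 `^ theta *
    (2 `^ eta * F n))); first by rewrite ler_wpM2l// mulr_ge0 ?ltW.
  have hr : 2 `^ theta * 2 `^ eta <= 2 * rho.
    rewrite -pD mulrC -ler_pdivrMr//.
    by rewrite /rho le_max -powR_inv1// -pD lexx orbT.
  have h2 : 0 <= 2 `^ (theta * n%:~R) * F n by rewrite mulr_ge0// ltW.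
  have := ler_wpM2r h2 hr.
  set x := 2 `^ (theta * n%:~R); set y := 2 `^ theta; set w := 2 `^ eta.
  have -> : x * y * (w * F n) = y * w * (x * F n) by ring.
  by have -> : rho * (2 * (x * F n)) = 2 * rho * (x * F n) by ring.
have [a [l [r h]]] := weighted_multiple bX sz delta0 rho0 rho1 phi0 dphi
  Dphi Ddec Dinc.
have bE n : 2 * delta / (1 - rho) * D n =
    2 `^ (theta * n%:~R) * (delta * A * F n).
  by rewrite /D AE; field; rewrite gt_eqF.
have sl n : sumspace X (l n) by have [] := h n => *; exact: sumspace0.
have sr n : sumspace X (r n) by have [] := h n => *; exact: sumspace1.
have slr n : sumspace X (l n + r n) by exact: sumspaceD.
have sa : sumspace X a.
  have [_ _ -> _] := h 0; apply: sumspaceD => //; exact: sumspaceZ.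
have Klr n : 2 `^ (- theta * n%:~R) * kfun X (dyadic n) (l n + r n) <=
    delta * A * F n.
  have [Al Ar _ hn] := h n; rewrite mulNr powRN mulrC ler_pdivrMr// mulrC -bE.
  by apply: le_trans hn; exact: kfun_le.
(* The element a and the multiple phi n z differ by l n + r n, which is small at scale 2^n. This
   direction gives the final estimate; the opposite one, [af], puts a in the interpolation space. *)
have fa n : f n <= disc X theta a n + delta * A * F n.
  have [_ _ aE _] := h n.
  have zE : phi n *: z = a + (-1) *: (l n + r n).
    by rewrite aE scaleN1r addrK.
  have phin0 : phi n != 0 by rewrite gt_eqF.
  have := @kfunZ _ _ X (dyadic n) (phi n) z bX (dge0 n) phin0 sz.
  rewrite gtr0_norm// zE => Ez.
  have N1' : (-1 : R) != 0 by rewrite oppr_eq0 oner_eq0.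
  have := kfunD bX (dge0 n) sa (sumspaceZ (-1) bX (slr n)).
  rewrite (kfunZ bX (dge0 n) N1' (slr n)) normrN1 mul1r Ez => hk.
  have := ler_wpM2l (ltW (p0 (- theta * n%:~R))) hk.
  have := Klr n; rewrite /f /disc; nra.
have af n : disc X theta a n <= f n + delta * A * F n.
  have [_ _ aE _] := h n.
  have phin0 : phi n != 0 by rewrite gt_eqF.
  have := kfunD bX (dge0 n) (sumspaceZ (phi n) bX sz) (slr n).
  rewrite (kfunZ bX (dge0 n) phin0 sz) gtr0_norm// -aE => hk.
  have := ler_wpM2l (ltW (p0 (- theta * n%:~R))) hk.
  have := Klr n; rewrite /f /disc; nra.
have dA0 : 0 <= delta * A by rewrite mulr_ge0.
have F0 n : 0 <= F n by rewrite ltW.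
have CmM0 : 0 <= Cm * M by rewrite mulr_ge0// ltW.
have FM' : lbound q (fun n => delta * A * F n) (delta * A * (Cm * M)).
  exact: lboundZ.
have th0' := ltW th0.
have aX : interp_space X theta q a.
  pose M' := M + delta * A * (Cm * M).
  have M'0 : 0 <= M' by rewrite addr_ge0// mulr_ge0.
  apply: (@lbound_interp_space _ _ _ _ (4 * M')) => //; first by rewrite mulr_ge0.
  apply: (le_lbound q1 _ af) => [n|]; first exact: disc_ge0.
  apply: lboundD => //; first by move=> n; rewrite mulr_ge0.
    by apply: lbound_le fM => //; rewrite lerDl mulr_ge0.
  by apply: lbound_le FM' => //; rewrite ?lerDr// (mulr_ge0 dA0).
(* The kernel condition removes phi n z, so T a has a cheap decomposition at every scale. *)
have TaE n : T a = T (l n) + T (r n).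
  have [_ _ -> _] := h n; rewrite TD//; last exact: sumspaceZ.
  by rewrite TZ// Tz scaler0 add0r TD.
have sTa : sumspace Y (T a).
  exists (T (l 0)), (T (r 0)); have [Al Ar _ _] := h 0.
  by rewrite -TaE; split => //; [case: T0 => + _|case: T1 => + _]; apply.
have Ta n : disc Y theta (T a) n <= CT * (delta * A * F n).
  have [Al Ar _ hn] := h n.
  rewrite /disc mulNr powRN mulrC ler_pdivrMr// [leRHS]mulrC mulrCA -bE (TaE n).
  have B0 : cA0 Y (T (l n)) by case: T0 => + _; apply.
  have B1' : cA1 Y (T (r n)) by case: T1 => + _; apply.
  apply: (le_trans (kfun_le bY (dge0 n) B0 B1')).
  apply: (@le_trans _ _ (CT * (cn0 X (l n) + dyadic n * cn1 X (r n)))); last first.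
    by rewrite ler_wpM2l.
  rewrite mulrDr mulrCA; apply: lerD.
    apply: (le_trans (hC0 _ Al)); rewrite ler_wpM2r ?n00//.
    by rewrite /CT lerDl.
  rewrite ler_wpM2l// (le_trans (hC1 _ Ar))// ler_wpM2r ?n10//.
  by rewrite /CT lerDr.
have TaM : lbound q (disc Y theta (T a)) (CT * (delta * A * (Cm * M))).
  apply: (le_lbound q1 _ Ta) => [n|]; first exact: disc_ge0.
  by apply: lboundZ => //; [rewrite mulr_ge0|move=> n; rewrite mulr_ge0].
pose N := CT * (delta * A * (Cm * M)).
have N0' : 0 <= N by rewrite !mulr_ge0 ?(ltW Cm0).
have nTa := interp_norm_le bY th0' q1 sTa N0' TaM.
have na : (interp_norm X theta q a <= (`|C| * (2 * N))%:E)%E.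
  apply: (le_trans (hC _ aX)); rewrite EFinM.
  apply: (@le_trans _ _ (`|C|%:E * interp_norm Y theta q (T a))%E).
    (* Replacing C by its absolute value requires a nonnegative norm; for q = +oo this is read off
       from the supremum at t = 1. *)
    apply: lee_wpmul2r; last by rewrite lee_fin ler_norm.
    case: (q) q1 => [s||]//= _; first exact: poweR_ge0.
    apply: (@le_trans _ _ ((1 `^ (- theta))%:E * Kfun Y 1 (T a))%E).
      by rewrite mule_ge0 ?lee_fin ?powR_ge0// Kfun_ge0.
    by apply: ereal_sup_ubound; exists 1.
  by apply: lee_wpmul2l => //; rewrite lee_fin.
have aM : lbound q (disc X theta a) (2 * 2 `^ theta * (`|C| * (2 * N))).
  by apply: lbound_disc => //; rewrite !mulr_ge0 ?(ltW Cm0).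
have N1E : 2 * 2 `^ theta * (`|C| * (2 * N)) = B1 * (delta * M).
  by rewrite /N B1E; ring.
rewrite N1E in aM.
have -> : 4 * (B1 + A * Cm) * delta * M = 4 * ((B1 + A * Cm) * (delta * M)).
  by ring.
have dM0 : 0 <= delta * M by rewrite mulr_ge0.
apply: (le_lbound q1 f0 fa); apply: lboundD => //.
- by rewrite mulr_ge0// addr_ge0.
- by move=> n; exact: disc_ge0.
- by move=> n; rewrite mulr_ge0.
- by apply: lbound_le aM => //; rewrite ?mulr_ge0// ler_wpM2r// lerDl.
- apply: lbound_le FM' => //; first by rewrite mulr_ge0.
  have -> : delta * A * (Cm * M) = A * Cm * (delta * M) by ring.
  by rewrite ler_wpM2r// lerDr.
Qed.

(** Truncation at 1 preserves the two-sided ratio bound 1 + delta, and such a ratio bound gives the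
    difference bound. *)
Lemma min_slow (R : realType) (c y delta : R) : 0 < y -> 0 <= delta ->
  c <= 1 + delta -> c^-1 <= 1 + delta -> 0 < c ->
  `|Num.min 1 (c * y) - Num.min 1 y| <= delta * Num.min 1 y.
Proof.
move=> y0 d0 c1 c2 cp.
have h1 : 1 <= (1 + delta) * c by rewrite -ler_pdivrMr// div1r.
have up : Num.min 1 (c * y) <= (1 + delta) * Num.min 1 y.
  by rewrite /Num.min; do 2 case: ifP; move=> /= ? ?; nra.
have dn : Num.min 1 y <= (1 + delta) * Num.min 1 (c * y).
  have h2 : y <= (1 + delta) * (c * y) by rewrite mulrA ler_peMl// ltW.
  have h3 : 0 < c * y by rewrite mulr_gt0.
  by rewrite /Num.min; do 2 case: ifP; move=> /= ? ?; nra.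
have m0 : 0 < Num.min 1 y by rewrite lt_min ltr01.
have p0 : 0 < Num.min 1 (c * y) by rewrite lt_min ltr01 mulr_gt0.
move: up dn m0 p0.
set m := Num.min 1 y; set p := Num.min 1 (c * y) => up dn m0 p0.
by rewrite ler_norml; apply/andP; split; nra.
Qed.

Lemma local_injectivity (R : realType) (U W : topologicalLmodType R)
  (X : couple U) (Y : couple W) (T : U -> W) (q : \bar R) (theta : R) :
  banach_couple X -> banach_couple Y -> (1 <= q)%E -> couple_operator X Y T ->
  0 < theta -> theta < 1 -> interp_invertible X Y T q theta ->
  exists2 e, 0 < e & forall theta', 0 < theta' -> `|theta - theta'| < e ->
  forall x x', interp_space X theta q x -> interp_space X theta' q x' ->
  T x = T x' -> x = x'.
Proof.
move=> bX bY q1 TXY th0 th1 [_ _ below].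
have [B B0 contr] := kernel_contraction bX bY q1 TXY th0 th1 below.
(* Chosen so that B delta <= 1/2; the summand 1 keeps the denominator positive when B = 0. *)
pose delta := (2 * (B + 1))^-1.
have B1 : 0 < B + 1 by rewrite ltr_wpDl.
have delta0 : 0 < delta by rewrite invr_gt0 mulr_gt0.
have Bdelta : B * delta <= 2^-1.
  by rewrite /delta invfM mulrCA ler_piMr// ler_pdivrMr// mul1r lerDl.
have l2 : 0 < ln (2 : R) by rewrite ln_gt0// ltr1n.
have d1 : 0 < 1 + delta by rewrite addr_gt0.
(* This is log2 (1 + delta): for closer parameters 2^(theta - theta') and its inverse are at most 1
   + delta. *)
exists (ln (1 + delta) / ln 2).
  by rewrite divr_gt0// ln_gt0// ltrDl.
move=> theta' th'0 close x x' xX x'X' Txx'.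
pose z := x + (-1) *: x'.
have [sx _] := xX; have [sx' _] := x'X'.
have sNx' : sumspace X ((-1) *: x') by exact: sumspaceZ.
have sz : sumspace X z by exact: sumspaceD.
suff Kz : kfun X 1 z = 0.
  by apply/eqP; rewrite -subr_eq0 -scaleN1r; apply/eqP; exact: kfun_eq0 Kz.
apply/eqP; apply: contraT => Kz0.
have Kz : 0 < kfun X 1 z by rewrite lt_def Kz0 kfun_ge0.
have Tz : T z = 0.
  by have [[TD TZ] _ _] := TXY; rewrite TD// TZ// Txx' scaleN1r subrr.
pose beta := theta - theta'.
pose y (n : int) : R := 2 `^ (beta * n%:~R).
have y0 n : 0 < y n by exact: powR_gt0.
(* Then phi n 2^(- theta n) is the minimum of 2^(- theta n) and 2^(- theta' n), so x can be measured
   at theta and x' at theta'. *)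
pose phi n := Num.min 1 (y n).
have phi0 n : 0 < phi n by rewrite lt_min ltr01 y0.
have pow_small (b : R) : `|b| = `|beta| -> 2 `^ b <= 1 + delta.
  move=> bE; rewrite /powR pnatr_eq0/= -[leRHS]lnK// ler_expR -ler_pdivlMr//.
  by rewrite (le_trans (ler_norm _))// bE ltW.
have dphi n : `|phi (n + 1) - phi n| <= delta * phi n.
  have -> : phi (n + 1) = Num.min 1 (2 `^ beta * y n).
    rewrite /phi /y -powRD ?pnatr_eq0 ?implybT//.
    by rewrite intrD mulrDr mulr1 addrC.
  apply: min_slow => //; rewrite ?powR_gt0// ?(ltW delta0)//.
    exact: pow_small.
  by rewrite -powRN; apply: pow_small; rewrite normrN.
pose f n := phi n * disc X theta z n.
have f0 n : 0 <= f n by rewrite mulr_ge0 ?disc_ge0// ltW.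
have dge0 n : 0 <= dyadic n :> R by rewrite ltW// dyadic_gt0.
have p0 (s : R) : 0 < 2 `^ s by exact: powR_gt0.
have fxx' n : f n <= disc X theta x n + disc X theta' x' n.
  have := kfunD bX (dge0 n) sx sNx'.
  have N1 : (-1 : R) != 0 by rewrite oppr_eq0 oner_eq0.
  rewrite (kfunZ bX (dge0 n) N1 sx') normrN1 mul1r -/z => hz.
  have w1 : phi n * 2 `^ (- theta * n%:~R) <= 2 `^ (- theta * n%:~R).
    by rewrite ler_piMl ?(ltW (p0 _))// /phi ge_min lexx.
  have w2 : phi n * 2 `^ (- theta * n%:~R) <= 2 `^ (- theta' * n%:~R).
    apply: (@le_trans _ _ (y n * 2 `^ (- theta * n%:~R))).
      by rewrite ler_wpM2r ?(ltW (p0 _))// /phi ge_min lexx orbT.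
    rewrite /y -powRD ?pnatr_eq0 ?implybT// -mulrDl /beta.
    by rewrite addrAC subrr add0r.
  rewrite /f /disc mulrA.
  apply: (@le_trans _ _ (phi n * 2 `^ (- theta * n%:~R) *
    (kfun X (dyadic n) x + kfun X (dyadic n) x'))).
    by rewrite ler_wpM2l// mulr_ge0 ?ltW.
  by rewrite mulrDr lerD// ler_wpM2r// kfun_ge0.
have [M1 M10 hM1] := interp_space_lbound bX (ltW th0) q1 xX.
have [M2 M20 hM2] := interp_space_lbound bX (ltW th'0) q1 x'X'.
pose M := 4 * (M1 + M2).
have M0 : 0 <= M by rewrite mulr_ge0// addr_ge0.
have fM : lbound q f M.
  apply: (le_lbound q1 f0 fxx'); apply: lboundD => //.
  - by rewrite addr_ge0.
  - by move=> n; exact: disc_ge0.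
  - by move=> n; exact: disc_ge0.
  - by apply: lbound_le hM1 => //; rewrite lerDl.
  - by apply: lbound_le hM2 => //; rewrite lerDr.
(* Each application of the contraction halves the bound, which forces f 0 = 0 and contradicts K(1,
   z) > 0. *)
have iter (j : nat) : lbound q f (M * 2^-1 ^+ j).
  elim: j => [|j ih]; first by rewrite expr0 mulr1.
  have Mj0 : 0 <= M * 2^-1 ^+ j by rewrite mulr_ge0// exprn_ge0// invr_ge0.
  apply: (lbound_le q1 _ _ (contr z phi delta _ sz Tz Kz (ltW delta0) Mj0 phi0
    dphi ih)); first by rewrite (mulr_ge0 _ Mj0)// mulr_ge0// ltW.
  by rewrite exprS [leRHS]mulrCA ler_wpM2r.
have f00 : 0 < f 0.
  by rewrite mulr_gt0// /disc mulr_gt0// /dyadic powRr0.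
have /cvgrPdist_lt : geometric M 2^-1 @ \oo --> (0 : R).
  by apply: cvg_geometric; rewrite ger0_norm ?invr_ge0// invf_lt1// ltr1n.
move=> /(_ _ f00) [N _ hN]; have := hN N (leqnn N).
rewrite /= sub0r normrN => /(le_lt_trans (ler_norm _)); rewrite ltNge.
rewrite (lbound_ge 0 q1 _ f0 (iter N))//.
by rewrite mulr_ge0// exprn_ge0// invr_ge0.
Qed.

(** * Propagation along the interval *)

Lemma connected_locally_constant (R : realType) (A : set R) (Q : R -> Prop) :
  connected A ->
  (forall s, A s -> exists2 e, 0 < e & forall t, A t -> `|s - t| < e ->
     (Q s <-> Q t)) ->
  forall s t, A s -> A t -> Q s -> Q t.
Proof.
move=> cA loc s t As At Qs.
(* An open set covering the points of A where P holds, made of balls on which Q is constant along A.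
   With P = Q it shows that Q is relatively open in A, with P the negation of Q that it is
   relatively closed. *)
pose nb (P : R -> Prop) : set R := \bigcup_(p in [set p : R * R |
  [/\ A p.1, P p.1, 0 < p.2 &
   forall t, A t -> `|p.1 - t| < p.2 -> (Q p.1 <-> Q t)]]) ball p.1 p.2.
have open_nb P : open (nb P) by apply: bigcup_open => p _; exact: ball_open.
have in_nb (P : R -> Prop) u : A u -> P u -> nb P u.
  move=> Au Pu; have [e e0 h] := loc u Au.
  by exists (u, e) => /=; [split|exact: ballxx].
pose B := A `&` Q.
have BA : B = A.
  apply: cA; first by exists s.
    exists (nb Q) => //; apply/seteqP; split => u [Au].
      by move=> Qu; split => //; exact: in_nb.
    by move=> [[v e] /= [Av Qv e0 h]] vu; split => //; apply/(h u Au).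
  exists (~` nb (fun v => ~ Q v)); first exact: open_closedC.
  apply/seteqP; split => u [Au].
    move=> Qu; split => // -[[v e] /= [Av nQv e0 h]] vu.
    by apply: nQv; apply/(h u Au).
  by move=> nnb; split => //; apply: contrapT => nQu; apply: nnb; exact: in_nb.
by have [_] : B t by rewrite BA.
Qed.

(** The weight 2^(- t n) is at most 2^(- s n) for n >= 0 and at most 2^(- u n) for n < 0. This
    provides y with a preimage at every intermediate parameter. *)
Lemma interp_space_between (R : realType) (V : topologicalLmodType R)
  (X : couple V) (q : \bar R) (s t u : R) (a : V) :
  banach_couple X -> (1 <= q)%E -> 0 < s -> s <= t -> t <= u ->
  interp_space X s q a -> interp_space X u q a -> interp_space X t q a.
Proof.
move=> bX q1 s0 st tu as_ au; have [sa _] := as_.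
have t0 := lt_le_trans s0 st; have u0 := lt_le_trans t0 tu.
have [M1 M10 h1] := interp_space_lbound bX (ltW s0) q1 as_.
have [M2 M20 h2] := interp_space_lbound bX (ltW u0) q1 au.
have M0 : 0 <= M1 + M2 by rewrite addr_ge0.
have d0 v n : 0 <= disc X v a n by exact: disc_ge0.
have le n : disc X t a n <= disc X s a n + disc X u a n.
  have k0 : 0 <= kfun X (dyadic n) a by rewrite kfun_ge0// ltW// dyadic_gt0.
  rewrite /disc -mulrDl ler_wpM2r//.
  have [n0|n0] := leP 0 (n%:~R : R).
    apply: (@le_trans _ _ (2 `^ (- s * n%:~R))); last by rewrite lerDl powR_ge0.
    by apply: ler_powR; rewrite ?ler1n// ler_wpM2r// lerN2.
  apply: (@le_trans _ _ (2 `^ (- u * n%:~R))); last by rewrite lerDr powR_ge0.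
  by apply: ler_powR; rewrite ?ler1n// ler_wnM2r ?(ltW n0)// lerN2.
apply: (@lbound_interp_space _ _ _ _ (4 * (M1 + M2))) => //; rewrite ?mulr_ge0//.
  exact: ltW.
apply: (le_lbound q1 _ le) => //; apply: lboundD => //.
  by apply: lbound_le h1 => //; rewrite lerDl.
by apply: lbound_le h2 => //; rewrite lerDr.
Qed.

Theorem theorem4p9 (R : realType) (U W : topologicalLmodType R)
  (X : couple U) (Y : couple W) (T : U -> W) (q : \bar R) (I : set R) :
  banach_couple X -> banach_couple Y -> (1 <= q)%E ->
  couple_operator X Y T ->
  invertibility_interval X Y T q I ->
  forall theta0 theta1 : R, I theta0 -> I theta1 ->
  forall y : W, interp_space Y theta0 q y -> interp_space Y theta1 q y ->
  forall x0 x1 : U,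
    interp_space X theta0 q x0 -> T x0 = y ->
    interp_space X theta1 q x1 -> T x1 = y ->
    x0 = x1.
Proof.
move=> bX bY q1 TXY [theta [_ IE]] theta0 theta1 I0 I1 y y0 y1 x0 x1 x0X Tx0 x1X Tx1.
wlog le01 : theta0 theta1 I0 I1 y0 y1 x0 x1 x0X Tx0 x1X Tx1 / theta0 <= theta1.
  move=> hw; case/orP: (le_total theta0 theta1) => h.
    exact: (hw theta0 theta1).
  by apply/esym; exact: (hw theta1 theta0).
have itvI : is_interval I.
  by apply/connected_intervalP; rewrite IE; exact: component_connected.
have inv t : I t -> invertibility_set X Y T q t.
  by rewrite IE; exact: connected_component_sub.
have mem t : `[theta0, theta1]%classic t -> [/\ theta0 <= t, t <= theta1 & I t].
  rewrite /= in_itv/= => /andP[h0 h1]; split => //.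
  by apply: (itvI theta0 theta1) => //; rewrite h0.
have [th00 _ [_ inj0 _]] := inv _ I0; have [_ _ [_ inj1 _]] := inv _ I1.
have yt t : `[theta0, theta1]%classic t -> interp_space Y t q y.
  by move=> /mem[h0 h1 _]; exact: interp_space_between y0 y1.
(* The preimage of y at parameter t is still x0. This property is locally constant on the segment,
   since near s the preimages at s and at t coincide by local injectivity at s. *)
pose Q t := forall x, interp_space X t q x -> T x = y -> x0 = x.
have Q0 : Q theta0 by move=> x xX Tx; apply: inj0 => //; rewrite Tx0 Tx.
suff : Q theta1 by apply.
apply: (connected_locally_constant (@segment_connected _ theta0 theta1) _ _ _ Q0).
- move=> s As; have [_ _ Is] := mem s As.
  have [s0 s1 invs] := inv s Is; have [surs _ _] := invs.
  have [e e0 loc] := local_injectivity bX bY q1 TXY s0 s1 invs.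
  exists e => // t At st; have [_ _ It] := mem t At.
  have [t0 _ [surt _ _]] := inv t It.
  have [xs [xsX Txs]] := surs _ (yt s As).
  have [xt [xtX Txt]] := surt _ (yt t At).
  split => [Qs x xX Tx|Qt x xX Tx].
    by rewrite (Qs xs)//; apply: (loc t) => //; rewrite Txs Tx.
  by rewrite (Qt xt)//; apply/esym; apply: (loc t) => //; rewrite Tx Txt.
- by rewrite /= in_itv/= lexx.
- by rewrite /= in_itv/= le01 lexx.
Qed.
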